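(* Let $E\subset\mathbb H^1$ be a compact set, $U\subset\mathbb H^1$ a compact set, and $\varepsilon$ a function of $r>0$ with $\varepsilon(r)\to0$ as $r\to0$, such that $$d_\infty(B,Z_{A,r})\le\varepsilon(r)\,r\quad\text{for all }B\in E_{A,r}\text{ and all }A\in E\cap U .$$ Then there exists $F\in C^1_H(\mathbb H^1,\mathbb R^2)$ such that $F=0$ on $E\cap U$ and $d_hF(A)=\operatorname{Id}$ for every $A\in E\cap U$.
   Context: The Heisenberg group $\mathbb H^1$ is $\mathbb R^3$ with the law $(x,y,z)(x',y',z')=(x+x',y+y',z+z'+2x'y-2xy')$, dilations $\delta_t(x,y,z)=(tx,ty,t^2z)$, projection $\pi(x,y,z)=(x,y)$. Put $\rho_\infty(x,y,z)=\max\{\sqrt{x^2+y^2},|z|^{1/2}\}$ and $d_\infty(A,B)=\rho_\infty(B^{-1}A)$ (a left-invariant metric); $\bar B_\infty(A,r)$ is the closed ball. $E_{A,r}=E\cap\bar B_\infty(A,r)$; $Z_A=\{B:\pi(B)=\pi(A)\}$, $Z_{A,r}=Z_A\cap\bar B_\infty(A,r)$; $d_\infty(B,Z_{A,r})$ is the distance from a point to a set. The inequality is assumed for all $r>0$. A map $F:\mathbb H^1\to\mathbb R^2$ is horizontally differentiable at $A$ if there is a continuous group homomorphism $L:\mathbb H^1\to\mathbb R^2$ with $L(\delta_tB)=tL(B)$ ($t>0$) and $\|F(AB)-F(A)-L(B)\|=o(\rho_\infty(B))$ as $B\to0$; then $D_hF(A):=L$. $F\in C^1_H$ if this holds at every $A$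 and $A\mapsto D_hF(A)$ is continuous. $d_hF(A):\mathbb R^2\to\mathbb R^2$ is the linear map $d_hF(A)(x,y)=D_hF(A)(x,y,0)$. *)

(* Defs.v *)
From HB Require Import structures.
From mathcomp Require Import all_boot all_order all_algebra.
From mathcomp Require Import ring lra.
From mathcomp Require Import all_classical all_reals all_analysis.
Set Implicit Arguments.
Unset Strict Implicit.
Unset Printing Implicit Defensive.
Import Order.TTheory GRing.Theory Num.Theory.
Import numFieldNormedType.Exports.
Local Open Scope classical_set_scope.
Local Open Scope ring_scope.

(* The point (x, y, z) is the nested pair ((x, y), z).  Only the product
   topology of R * R * R is transported to heis R: its additive group
   structure and its sup norm are not those of the Heisenberg group. *)
Definition heis (R : realType) : Type := (R * R * R)%type.

HB.instance Definition _ (R : realType) :=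
  Topological.copy (heis R) (R * R * R)%type.

Section heis_group.
Variable R : realType.
Implicit Types A B C : heis R.

Definition heis_one : heis R := (0, 0, 0).

Definition heis_inv A : heis R := let: (x, y, z) := A in (- x, - y, - z).

Definition heis_mul A B : heis R :=
  let: (x, y, z) := A in let: (x', y', z') := B in
  (x + x', y + y', z + z' + 2 * x' * y - 2 * x * y').

Lemma heis_mulA : associative heis_mul.
Proof.
by move=> [[x y] z] [[x' y'] z'] [[x'' y''] z''] /=;
   congr (_, _, _); ring.
Qed.

Lemma heis_mul1g : left_id heis_one heis_mul.
Proof. by move=> [[x y] z] /=; congr (_, _, _); ring. Qed.

Lemma heis_mulg1 : right_id heis_one heis_mul.
Proof. by move=> [[x y] z] /=; congr (_, _, _); ring. Qed.

Lemma heis_mulVg : left_inverse heis_one heis_inv heis_mul.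
Proof. by move=> [[x y] z] /=; congr (_, _, _); ring. Qed.

Lemma heis_mulgV : right_inverse heis_one heis_inv heis_mul.
Proof. by move=> [[x y] z] /=; congr (_, _, _); ring. Qed.

End heis_group.

HB.instance Definition _ (R : realType) := isGroup.Build (heis R)
  (@heis_mulA R) (@heis_mul1g R) (@heis_mulg1 R)
  (@heis_mulVg R) (@heis_mulgV R).

Section heis_metric.
Variable R : realType.
Implicit Types (A B C : heis R) (S : set (heis R)) (r t : R).

(* The library norm on R * R is the sup norm, hence this definition. *)
Definition enorm (p : R * R) : R := Num.sqrt (p.1 ^+ 2 + p.2 ^+ 2).

Definition heis_dil t A : heis R :=
  let: (x, y, z) := A in (t * x, t * y, t ^+ 2 * z).

Definition heis_proj A : R * R := A.1.

Definition rho_infty A : R :=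
  Num.max (enorm (heis_proj A)) (Num.sqrt `|A.2|).

Definition d_infty A B : R := rho_infty (B^-1 * A)%g.

Definition heis_cball A r : set (heis R) := [set B | d_infty A B <= r].

Definition dist_to B S : R := inf [set d_infty B C | C in S].

Definition fiber A : set (heis R) := [set B | heis_proj B = heis_proj A].

End heis_metric.

Section horizontal_derivative.
Variable R : realType.
Implicit Types (F L : heis R -> R * R) (A B : heis R).

Definition homogeneous_hom L : Prop :=
  [/\ continuous L,
      forall A B, L (A * B)%g = L A + L B &
      forall t B, 0 < t -> L (heis_dil t B) = t *: L B].

Definition is_hderiv F A L : Prop :=
  homogeneous_hom L /\
  forall e : R, 0 < e ->
    \forall B \near (1%g : heis R),
      enorm (F (A * B)%g - F A - L B) <= e * rho_infty B.

Definition hdifferentiable F A : Prop := exists L, is_hderiv F A L.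

(* Some horizontal derivative of F at A (it is unique when it exists), and the
   zero map if there is none. *)
Definition Dh F A : heis R -> R * R := xget (fun=> 0) [set L | is_hderiv F A L].

(* Continuity of A |-> Dh F A is with respect to the operator norm
   sup { enorm (L B) | rho_infty B <= 1 }. *)
Definition C1H F : Prop :=
  (forall A, hdifferentiable F A) /\
  forall A, forall e : R, 0 < e ->
    \forall A' \near A, forall B,
      rho_infty B <= 1 -> enorm (Dh F A' B - Dh F A B) <= e.

Definition dh F A : R * R -> R * R := fun p => Dh F A (p.1, p.2, 0).

End horizontal_derivative.

(* Main.v *)
(** The data [f = 0], [L = pi] on [K = E `&` U] satisfy a Whitney condition: a point of
    the fiber of [A] projects to [pi A], so the hypothesis with [r = d A B] gives
    [|pi B - pi A| <= eps(r) r].  Writing [F = pi - (f, g)], it suffices to extend each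
    coordinate function [u] on [K] to a C^1_H function with vanishing horizontal
    derivative on [K].  At scale [r_n = 8^-n] average [u] over a maximal [r_n]-separated
    net of [K] with C^1 weights; boundedly many weights overlap, so near [K] the average
    oscillates by [o(r_n)] and has gradient [o(1)].  The extension uses the
    average at a scale comparable to the distance to [K], blending consecutive scales.
    That a function with continuous derivatives along the fields X and Y is C^1_H
    follows from the mean value theorem along a path of six horizontal segments. *)
Require Import Defs.
From mathcomp Require Import all_boot all_order all_algebra.
From mathcomp Require Import all_classical all_reals all_analysis.
From mathcomp Require Import ring lra.
Import Order.TTheory GRing.Theory Num.Theory.
Import numFieldNormedType.Exports.
Local Open Scope classical_set_scope.
Local Open Scope ring_scope.
Set Implicit Arguments.
Unset Strict Implicit.
Unset Printing Implicit Defensive.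

(** * The metric *)

Section metric.
Context {R : realType}.
Implicit Types A B C p q : heis R.

Lemma rho_leE A (t : R) : 0 <= t ->
  (rho_infty A <= t) = (A.1.1 ^+ 2 + A.1.2 ^+ 2 <= t ^+ 2) && (`|A.2| <= t ^+ 2).
Proof.
move=> t0; rewrite /rho_infty ge_max /enorm /heis_proj.
have sq0 : 0 <= A.1.1 ^+ 2 + A.1.2 ^+ 2 by rewrite addr_ge0// sqr_ge0.
rewrite -[X in (_ <= X) && (_ <= X)]ger0_norm// -sqrtr_sqr.
by rewrite !ler_sqrt// sqr_ge0.
Qed.

Lemma rho_ge0 A : 0 <= rho_infty A.
Proof. by rewrite /rho_infty le_max sqrtr_ge0. Qed.

Lemma rho_proj A : A.1.1 ^+ 2 + A.1.2 ^+ 2 <= rho_infty A ^+ 2.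
Proof. by have := lexx (rho_infty A); rewrite rho_leE ?rho_ge0// => /andP[]. Qed.

Lemma rho_x A : `|A.1.1| <= rho_infty A.
Proof.
rewrite -ler_sqr ?nnegrE ?rho_ge0// real_normK ?num_real//.
by apply: le_trans (rho_proj A); rewrite lerDl sqr_ge0.
Qed.

Lemma rho_y A : `|A.1.2| <= rho_infty A.
Proof.
rewrite -ler_sqr ?nnegrE ?rho_ge0// real_normK ?num_real//.
by apply: le_trans (rho_proj A); rewrite lerDr sqr_ge0.
Qed.

Lemma rho_z A : `|A.2| <= rho_infty A ^+ 2.
Proof. by have := lexx (rho_infty A); rewrite rho_leE ?rho_ge0// => /andP[]. Qed.

Lemma rho_one : rho_infty (1%g : heis R) = 0.
Proof.
by apply/eqP; rewrite eq_le rho_ge0 andbT rho_leE//= normr0 !expr0n/= addr0 lexx.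
Qed.

Lemma rhoV A : rho_infty A^-1%g = rho_infty A.
Proof. by case: A => [[x y] z]; rewrite /rho_infty /enorm /= !sqrrN normrN. Qed.

(** By Lagrange's identity the inner product and the determinant of the horizontal parts are both at
    most [a * b]. The first gives the horizontal bound; the second gives the vertical one, since the
    group law adds twice the determinant to [z + z']. *)
Lemma rhoM A B : rho_infty (A * B)%g <= rho_infty A + rho_infty B.
Proof.
have a0 := rho_ge0 A; have b0 := rho_ge0 B.
have := rho_proj A; have := rho_z A; have := rho_proj B; have := rho_z B.
rewrite rho_leE ?addr_ge0//.
move: (rho_infty A) (rho_infty B) a0 b0 => a b a0 b0.
case: A => [[x y] z]; case: B => [[x' y'] z'] /= hz' hp' hz hp.
have cs (s t : R) : s ^+ 2 <= (x ^+ 2 + y ^+ 2) * (x' ^+ 2 + y' ^+ 2) -> `|s| <= a * b.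
  move=> h; rewrite -ler_sqr ?nnegrE ?mulr_ge0// real_normK ?num_real//.
  apply: le_trans h _; rewrite exprMn.
  by apply: ler_pM => //; rewrite addr_ge0// sqr_ge0.
have h1 : `|x * x' + y * y'| <= a * b.
  apply: cs => //; rewrite -subr_ge0.
  have -> : (x ^+ 2 + y ^+ 2) * (x' ^+ 2 + y' ^+ 2) - (x * x' + y * y') ^+ 2
    = (x * y' - y * x') ^+ 2 by ring.
  exact: sqr_ge0.
have h2 : `|x' * y - x * y'| <= a * b.
  apply: cs => //; rewrite -subr_ge0.
  have -> : (x ^+ 2 + y ^+ 2) * (x' ^+ 2 + y' ^+ 2) - (x' * y - x * y') ^+ 2
    = (x * x' + y * y') ^+ 2 by ring.
  exact: sqr_ge0.
move: h1 h2; rewrite !ler_norml => /andP[h1 h1'] /andP[h2 h2'].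
move: hz hz'; rewrite !ler_norml => /andP[hz hz1] /andP[hz' hz1'].
by apply/andP; split; [|apply/andP; split]; nra.
Qed.

Lemma d_ge0 A B : 0 <= d_infty A B. Proof. exact: rho_ge0. Qed.

Lemma dC A B : d_infty A B = d_infty B A.
Proof. by rewrite /d_infty -rhoV invgM invgK. Qed.

Lemma d_triangle B A C : d_infty A C <= d_infty A B + d_infty B C.
Proof.
rewrite /d_infty addrC; have -> : (C^-1 * A = (C^-1 * B) * (B^-1 * A))%g.
  by rewrite mulgA mulgK.
exact: rhoM.
Qed.

Lemma dxx A : d_infty A A = 0. Proof. by rewrite /d_infty mulVg rho_one. Qed.

Lemma d_mulr A B : d_infty (A * B)%g A = rho_infty B.
Proof. by rewrite /d_infty mulKg. Qed.

End metric.

(** * Metric description of the product topology *)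

Section topology.
Context {R : realType}.
Implicit Types A B C p q : heis R.

Lemma mulV_x A B : (A^-1 * B)%g.1.1 = B.1.1 - A.1.1.
Proof. by case: A B => [[a b] c] [[x y] z] /=; ring. Qed.

Lemma mulV_y A B : (A^-1 * B)%g.1.2 = B.1.2 - A.1.2.
Proof. by case: A B => [[a b] c] [[x y] z] /=; ring. Qed.

Lemma mulV_z A B : (A^-1 * B)%g.2 =
  B.2 - A.2 - 2 * (B.1.1 - A.1.1) * A.1.2 + 2 * A.1.1 * (B.1.2 - A.1.2).
Proof. by case: A B => [[a b] c] [[x y] z] /=; ring. Qed.

(** [heis R] carries the product topology; with this lemma all later limits can be taken in
    [d_infty]. The vertical coordinate of [A^-1 * B] differs from [B.2 - A.2] by terms linear in the
    horizontal increments, and [m] absorbs their coefficients, which depend on [A] only. *)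
Lemma nbhs_heisP A (P : set (heis R)) :
  nbhs A P <-> exists2 r : R, 0 < r & forall B, d_infty B A <= r -> P B.
Proof.
have key B := mulV_z A B; have keyx B := mulV_x A B; have keyy B := mulV_y A B.
pose m := 1 + 2 * `|A.1.1| + 2 * `|A.1.2|.
have m1 : 1 <= m by rewrite /m -addrA lerDl addr_ge0// mulr_ge0.
have m0 : 0 < m by apply: lt_le_trans m1.
have na := normr_ge0 A.1.1; have nb := normr_ge0 A.1.2.
split.
  move=> /(@nbhs_ballP R (R * R * R)%type A P)[e /= e0 eP].
  exists (Num.min 1 (e / (2 * m))).
    by rewrite lt_min ltr01 divr_gt0// mulr_gt0.
  move=> B; rewrite le_min ler_pdivlMr ?mulr_gt0// => /andP[d1 dm].
  apply: eP.
  have d0 := d_ge0 B A.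
  have hx := rho_x (A^-1 * B)%g; have hy := rho_y (A^-1 * B)%g.
  have hz := rho_z (A^-1 * B)%g.
  rewrite keyx in hx; rewrite keyy in hy; rewrite key in hz.
  rewrite -/(d_infty B A) in hx hy hz.
  move: (d_infty B A) d0 d1 dm hx hy hz => d d0 d1 dm hx hy hz.
  have de : d < e by nra.
  have hz' : `|B.2 - A.2| <= d * m.
    have -> : B.2 - A.2 = B.2 - A.2 - 2 * (B.1.1 - A.1.1) * A.1.2 +
      2 * A.1.1 * (B.1.2 - A.1.2) + (2 * (B.1.1 - A.1.1) * A.1.2 - 
      2 * A.1.1 * (B.1.2 - A.1.2)) by ring.
    apply: le_trans (ler_normD _ _) _.
    apply: le_trans (lerD hz (ler_normB _ _)) _.
    rewrite !normrM (ger0_norm (ler0n R 2)) /m; nra.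
  split; [split|]; rewrite /ball /= distrC.
  - exact: le_lt_trans hx de.
  - exact: le_lt_trans hy de.
  - by apply: le_lt_trans hz' _; nra.
move=> [r r0 rP].
apply/(@nbhs_ballP R (R * R * R)%type A P).
exists (Num.min (r / 2) (r ^+ 2 / m)); first by rewrite /= lt_min !divr_gt0// exprn_gt0.
move=> B [[]]; rewrite /ball /= distrC => hx; rewrite distrC => hy; rewrite distrC => hz.
apply: rP; rewrite /d_infty rho_leE ?(ltW r0)//. rewrite keyx keyy key.
move: hx hy hz; rewrite !lt_min => /andP[hx hx'] /andP[hy hy'] /andP[_ hz].
have sq (t : R) : `|t| < r / 2 -> t ^+ 2 <= r ^+ 2 / 4.
  by rewrite ltr_norml => /andP[h1 h2]; nra.
apply/andP; split; first by have := sq _ hx; have := sq _ hy; nra.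
apply: le_trans (ler_normD _ _) _.
apply: le_trans (lerD (ler_normB _ _) (lexx _)) _.
rewrite !normrM (ger0_norm (ler0n R 2)).
have -> : r ^+ 2 = r ^+ 2 / m * m by rewrite divfK ?gt_eqF.
rewrite /m in hz hx' hy' *; nra.
Qed.

Lemma near_heisP A (P : heis R -> Prop) :
  (\forall B \near A, P B) <->
  exists2 r : R, 0 < r & forall B, d_infty B A <= r -> P B.
Proof. exact: nbhs_heisP. Qed.

Lemma cvg_heisP (f : heis R -> R) A :
  f B @[B --> A] --> f A <->
  forall e : R, 0 < e -> exists2 r : R, 0 < r &
    forall B, d_infty B A <= r -> `|f B - f A| <= e.
Proof.
split => [/cvgrPdist_le h e e0|h].
  have /near_heisP[r r0 hr] := h e e0.
  by exists r => // B /hr; rewrite distrC.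
apply/cvgrPdist_le => e e0; have [r r0 hr] := h e e0.
by apply/near_heisP; exists r => // B /hr; rewrite distrC.
Qed.

Lemma compact_heis_closed (K : set (heis R)) : compact K -> closed K.
Proof. by apply: compact_closed; exact: (@norm_hausdorff R (R * R * R)%type). Qed.

Lemma compact_dist_gt0 {K : set (heis R)} {p} : compact K -> ~ K p ->
  exists2 s : R, 0 < s & forall A, K A -> s <= d_infty p A.
Proof.
move=> /compact_heis_closed cK Kp.
have : nbhs p (~` K) by apply: open_nbhs_nbhs; split => //; exact: closed_openC.
move=> /nbhs_heisP[s s0 sK]; exists s => // A KA.
by rewrite leNgt; apply/negP => /ltW; rewrite dC => /sK.
Qed.

(** If no finite net existed, the points of [K] farther than [r] from every member of a finite list
    would generate a proper filter as the list varies. A cluster point [A] of it contradicts the set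
    given by the list [[:: A]]. *)
Lemma compact_finite_net (K : set (heis R)) (r : R) : compact K -> 0 < r ->
  exists s : seq (heis R), (forall q, q \in s -> K q) /\
    forall A, K A -> exists2 q, q \in s & d_infty A q <= r.
Proof.
move=> cK r0; apply: contrapT => nonet.
pose D := [set s : seq (heis R) | forall q, q \in s -> K q].
pose F (s : seq (heis R)) := K `&` [set A | forall q, q \in s -> r < d_infty A q].
have FF : Filter (filter_from D F).
  apply: filter_from_filter; first by exists [::].
  move=> s t Ds Dt; exists (s ++ t).
    by move=> q; rewrite mem_cat => /orP[/Ds|/Dt].
  by move=> A [KA h]; split; split => // q qs; apply: h; rewrite mem_cat qs ?orbT.
have PF : ProperFilter (filter_from D F).
  apply: filter_from_proper => // s Ds; apply: contrapT => ne.
  apply: nonet; exists s; split => // A KA; apply: contrapT => h.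
  apply: ne; exists A; split => //= q qs; rewrite ltNge; apply/negP => h'.
  by apply: h; exists q.
have FK : filter_from D F K by exists [::] => // A [].
have [A [KA clA]] := cK _ PF FK.
have FA : filter_from D F (F [:: A]).
  by exists [:: A] => // q; rewrite inE => /eqP ->.
have nA : nbhs A (heis_cball A r).
  by apply/nbhs_heisP; exists r => // B; rewrite /heis_cball /= dC.
have [B [[_ h] BA]] := clA _ _ FA nA.
by have := h A (mem_head _ _); rewrite ltNge dC BA.
Qed.

End topology.

(** * Derivatives along horizontal lines *)

Section horizontal_calculus.
Context {R : realType}.
Implicit Types (A B C p q : heis R) (f g : heis R -> R) (v : R * R).

(** The integral curve through [A] of the left-invariant field [v.1 X + v.2 Y]. *)
Definition hline A v (t : R) : heis R := (A * (((t * v.1)%R, (t * v.2)%R, 0%R) : heis R))%g.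

Lemma hlineE A v t :
  hline A v t = (A.1.1 + t * v.1, A.1.2 + t * v.2,
                 A.2 + 2 * (t * v.1) * A.1.2 - 2 * A.1.1 * (t * v.2)).
Proof. by case: A => [[x y] z]; rewrite /hline /=; congr (_, _, _); ring. Qed.

Lemma hline0 A v : hline A v 0 = A.
Proof.
by rewrite hlineE; case: A => [[x y] z] /=; congr (_, _, _); ring.
Qed.

Lemma hlineD A v s t : hline (hline A v s) v t = hline A v (s + t).
Proof. by rewrite !hlineE /=; congr (_, _, _); ring. Qed.

Lemma hlineM A B v t : (B * hline A v t)%g = hline (B * A)%g v t.
Proof. by rewrite /hline mulgA. Qed.

Definition dirset : set (R * R) := [set v | `|v.1| <= 1 /\ `|v.2| <= 1].

Lemma d_hline A v t : dirset v -> d_infty (hline A v t) A <= 2 * `|t|.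
Proof.
move=> [v1 v2]; rewrite d_mulr rho_leE ?mulr_ge0//= normr0.
rewrite exprn_ge0 ?mulr_ge0// andbT !exprMn.
have sq (w : R) : `|w| <= 1 -> w ^+ 2 <= 1.
  by rewrite ler_norml => /andP[h1 h2]; nra.
rewrite real_normK ?num_real//.
have := sq _ v1; have := sq _ v2; have := sqr_ge0 t; nra.
Qed.

Lemma is_derive1_continuous (h : R -> R) (x a : R) :
  is_derive x (1 : R) h a -> {for x, continuous h}.
Proof. by move=> [dh _]; apply: differentiable_continuous; apply/derivable1_diffP. Qed.

Definition hder f v A (a : R) :=
  is_derive (0 : R) (1 : R) (fun t : R => f (hline A v t)) a.

(** The derivative is a separate argument, so that the rules below build its formula along with the
    function. *)
Definition hC1 f (Df : R * R -> heis R -> R) :=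
  continuous f /\
  forall v, dirset v -> continuous (Df v) /\ forall A, hder f v A (Df v A).

Lemma hC1_cst (c : R) : hC1 (fun=> c) (fun _ _ => 0).
Proof.
split; first by move=> ?; exact: cvg_cst.
move=> v _; split; first by move=> ?; exact: cvg_cst.
by move=> A; exact: is_derive_cst.
Qed.

Lemma hC1D f g Df Dg : hC1 f Df -> hC1 g Dg ->
  hC1 (fun A => f A + g A) (fun v A => Df v A + Dg v A).
Proof.
move=> [cf hf] [cg hg]; split; first by move=> A; apply: cvgD; [exact: cf|exact: cg].
move=> v vd; have [cDf df] := hf v vd; have [cDg dg] := hg v vd; split.
  by move=> A; apply: cvgD; [exact: cDf|exact: cDg].
move=> A; have := df A; have := dg A => dgA dfA.
exact: (@is_deriveD _ _ _ (fun t => f (hline A v t)) (fun t => g (hline A v t))).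
Qed.

Lemma hC1M f g Df Dg : hC1 f Df -> hC1 g Dg ->
  hC1 (fun A => f A * g A) (fun v A => f A * Dg v A + g A * Df v A).
Proof.
move=> [cf hf] [cg hg]; split; first by move=> A; apply: cvgM; [exact: cf|exact: cg].
move=> v vd; have [cDf df] := hf v vd; have [cDg dg] := hg v vd; split.
  move=> A; apply: cvgD; apply: cvgM;
    [exact: cf|exact: cDg|exact: cg|exact: cDf].
move=> A.
have := @is_deriveM _ _ (fun t : R => f (hline A v t)) (fun t : R => g (hline A v t))
  0 1 _ _ (df A) (dg A).
by rewrite !hline0.
Qed.

Lemma hC1_comp (h h' : R -> R) f Df : (forall x : R, is_derive x (1 : R) h (h' x)) ->
  continuous h' -> hC1 f Df -> hC1 (h \o f) (fun v A => h' (f A) * Df v A).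
Proof.
move=> dh ch' [cf hf]; split.
  move=> A; apply: (cvg_comp _ _ (cf A)).
  exact: is_derive1_continuous (dh (f A)).
move=> v vd; have [cDf df] := hf v vd; split.
  move=> A; apply: cvgM; last exact: cDf.
  by apply: (cvg_comp _ _ (cf A)); exact: ch'.
move=> A; have dA := df A; rewrite /hder.
apply: (@is_derive1_comp _ h (fun t => f (hline A v t))) => //.
by rewrite hline0.
Qed.

Lemma hC1_sum (I : Type) (s : seq I) (F : I -> heis R -> R) DF :
  (forall i, hC1 (F i) (DF i)) ->
  hC1 (fun A => \sum_(i <- s) F i A) (fun v A => \sum_(i <- s) DF i v A).
Proof.
move=> hF; elim: s => [|i s ih].
  have := hC1_cst 0; congr hC1.
    by apply/funext => A; rewrite big_nil.
  by apply/funext => v; apply/funext => A; rewrite big_nil.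
have := hC1D (hF i) ih; congr hC1.
  by apply/funext => A; rewrite big_cons.
by apply/funext => v; apply/funext => A; rewrite big_cons.
Qed.

Lemma hder_near f g v A a : dirset v -> (\forall B \near A, f B = g B) ->
  hder f v A a -> hder g v A a.
Proof.
move=> vd /near_heisP[r r0 fg]; apply: near_eq_is_derive.
near=> t; apply: fg; apply: le_trans (d_hline _ _ vd) _.
have : `|t| <= r / 2.
  near: t; exists (r / 2); first by rewrite /= divr_gt0.
  by move=> t /=; rewrite sub0r normrN => /ltW.
by rewrite ler_pdivlMr// mulrC.
Unshelve. all: by end_near. Qed.

Lemma hder_line f v A a t : hder f v (hline A v t) a ->
  is_derive t (1 : R) (fun s => f (hline A v s)) a.
Proof.
rewrite /hder => h.
have -> : (fun s => f (hline A v s)) =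
  (fun s => f (hline (hline A v t) v s)) \o (fun s => s - t).
  by apply/funext => s /=; rewrite hlineD addrC subrK.
rewrite -[a]mulr1; apply: is_derive1_comp; first by rewrite subrr.
by rewrite -[X in is_derive _ _ _ X]subr0; apply: is_deriveB.
Qed.

Lemma hC1_mvt f Df v A t : hC1 f Df -> dirset v ->
  exists2 B, d_infty B A <= 2 * `|t| & f (hline A v t) - f A = Df v B * t.
Proof.
move=> [_ hf] vd; have [_ df] := hf v vd.
pose g s := f (hline A v s).
have dg s : is_derive s (1 : R) g (Df v (hline A v s)) by exact: hder_line.
have cg : continuous g.
  by move=> s; exact: is_derive1_continuous (dg s).
have cgw (a b : R) : {within `[a, b], continuous g} by exact: continuous_subspaceT.
have g0 : g 0 = f A by rewrite /g hline0.
have [t0|/ltW t0] := leP 0 t.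
  have [s] := MVT_segment t0 (fun x _ => dg x) (cgw _ _).
  rewrite in_itv /= subr0 g0 => /andP[s0 st] e; exists (hline A v s) => //.
  by apply: le_trans (d_hline _ _ vd) _; rewrite !ger0_norm// ler_pM2l.
have [s] := MVT_segment t0 (fun x _ => dg x) (cgw _ _).
rewrite in_itv /= sub0r g0 => /andP[ts s0] e; exists (hline A v s).
  by apply: le_trans (d_hline _ _ vd) _; rewrite !ler0_norm// ler_pM2l// lerN2.
by rewrite -[LHS]opprB e mulrN opprK.
Qed.

Lemma hder_unique f v A a b : hder f v A a -> hder f v A b -> a = b.
Proof. by move=> [_ <-] [_ <-]. Qed.

End horizontal_calculus.

(** * First-order expansion along horizontal paths *)

Section taylor.
Context {R : realType}.
Implicit Types (A B C p q : heis R) (f g : heis R -> R) (v : R * R).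

Definition dirX : R * R := (1, 0).
Definition dirY : R * R := (0, 1).

Lemma dirset_X : dirset dirX.
Proof. by split; rewrite /= ?normr0 ?normr1 ?ler01. Qed.

Lemma dirset_Y : dirset dirY.
Proof. by split; rewrite /= ?normr0 ?normr1 ?ler01. Qed.

(** The mean value point stays within [r] of [A], where [Df v] is within [e] of its value at [A]. *)
Lemma hC1_step f Df v A (r e : R) p t : hC1 f Df -> dirset v ->
  (forall q, d_infty q A <= r -> `|Df v q - Df v A| <= e) ->
  d_infty p A + 2 * `|t| <= r ->
  `|f (hline p v t) - f p - Df v A * t| <= e * `|t|.
Proof.
move=> hf vd he hp; have [q dq ->] := hC1_mvt p t hf vd.
rewrite -mulrBl normrM ler_wpM2r//; apply: he.
apply: le_trans (d_triangle p _ _) _; lra.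
Qed.

Lemma d_hline_step v A p t : dirset v ->
  d_infty (hline p v t) A <= d_infty p A + 2 * `|t|.
Proof.
move=> vd; apply: le_trans (d_triangle p _ _) _.
by rewrite addrC lerD2l d_hline.
Qed.

(* After the steps [B.1.1] and [B.1.2] the vertical defect [B.2 + 2 * B.1.1 * B.1.2]
   remains; the commutator [(s,0,0)(0,t,0)(-s,0,0)(0,-t,0) = (0,0,-4st)] fills it. *)
Lemma mul_hline_path A B : exists s t : R,
  [/\ `|s| <= rho_infty B, `|t| <= rho_infty B &
    (A * B)%g = hline (hline (hline (hline (hline (hline A dirX B.1.1)
      dirY B.1.2) dirX s) dirY t) dirX (- s)) dirY (- t)].
Proof.
pose w := B.2 + 2 * B.1.1 * B.1.2.
pose s := Num.sqrt `|w| / 2.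
have s0 : 0 <= s by rewrite divr_ge0.
have s2 : 4 * s ^+ 2 = `|w|.
  by rewrite expr_div_n sqr_sqrtr//; field.
have sB : s <= rho_infty B.
  rewrite -ler_sqr ?nnegrE ?rho_ge0//.
  have := rho_x B; have := rho_y B; have := rho_z B; rewrite !ler_norml.
  have : `|w| <= 3 * rho_infty B ^+ 2.
    apply: le_trans (ler_normD _ _) _.
    rewrite !normrM (ger0_norm (ler0n R 2)).
    have := rho_x B; have := rho_y B; have := rho_z B.
    have := normr_ge0 B.1.1; have := normr_ge0 B.1.2; nra.
  rewrite -s2; have := sqr_ge0 (rho_infty B); lra.
exists s, (- Num.sg w * s); split.
- by rewrite ger0_norm.
- rewrite normrM normrN normr_sg (ger0_norm s0); case: eqP => _ /=; last by rewrite mul1r.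
  by rewrite mul0r rho_ge0.
have hw : Num.sg w * (4 * s ^+ 2) = w by rewrite s2 -numEsg.
have hz : B.2 = Num.sg w * (4 * s ^+ 2) - 2 * B.1.1 * B.1.2 by rewrite hw /w; ring.
rewrite !hlineE /=; move: hz; move: (Num.sg _) (s) => g u.
clear; case: A B => [[a b] c] [[x y] z] /= ->.
by congr (_, _, _); ring.
Qed.

(** Each of the six segments of [mul_hline_path] contributes an error of at most
    [e / 6 * rho_infty B]. The main terms of the steps [s], [t] cancel those of [- s], [- t], and
    only the first two steps remain. *)
Lemma hC1_taylor f Df A (e : R) : hC1 f Df -> 0 < e ->
  \forall B \near (1%g : heis R),
    `|f (A * B)%g - f A - (Df dirX A * B.1.1 + Df dirY A * B.1.2)|
      <= e * rho_infty B.
Proof.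
move=> hf e0; have [_ hf'] := hf.
have [cX _] := hf' _ dirset_X; have [cY _] := hf' _ dirset_Y.
have e6 : 0 < e / 6 by rewrite divr_gt0.
have [r1 r10 h1] := (cvg_heisP _ _).1 (cX A) _ e6.
have [r2 r20 h2] := (cvg_heisP _ _).1 (cY A) _ e6.
(* By [d_hline], six steps of size at most [rho_infty B] move the point by at most
   [12 * rho_infty B]. *)
apply/near_heisP; exists (Num.min r1 r2 / 12).
  by rewrite divr_gt0// lt_min r10.
move=> B; rewrite /d_infty invg1 mul1g ler_pdivlMr// le_min => /andP[b1 b2].
have [s [t [hs ht ->]]] := mul_hline_path A B.
have := rho_x B; have := rho_y B; move: (rho_infty B) hs ht b1 b2.
move: B.1.1 B.1.2 => x y rho hs ht b1 b2 hy hx.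
set p1 := hline A dirX x; set p2 := hline p1 dirY y; set p3 := hline p2 dirX s.
set p4 := hline p3 dirY t; set p5 := hline p4 dirX (- s).
have dA := dxx A.
have d1 := d_hline_step A A x dirset_X.
have d2 := d_hline_step A p1 y dirset_Y.
have d3 := d_hline_step A p2 s dirset_X.
have d4 := d_hline_step A p3 t dirset_Y.
have d5 := d_hline_step A p4 (- s) dirset_X.
rewrite normrN in d5.
have := @hC1_step f Df dirX A r1 (e/6) A x hf dirset_X h1 ltac:(lra).
have := @hC1_step f Df dirY A r2 (e/6) p1 y hf dirset_Y h2
  ltac:(rewrite -/p1 in d1; lra).
have := @hC1_step f Df dirX A r1 (e/6) p2 s hf dirset_X h1
  ltac:(rewrite -/p1 -/p2 in d1 d2; lra).
have := @hC1_step f Df dirY A r2 (e/6) p3 t hf dirset_Y h2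
  ltac:(rewrite -/p1 -/p2 -/p3 in d1 d2 d3; lra).
have := @hC1_step f Df dirX A r1 (e/6) p4 (- s) hf dirset_X h1
  ltac:(rewrite -/p1 -/p2 -/p3 -/p4 normrN in d1 d2 d3 d4 *; lra).
have := @hC1_step f Df dirY A r2 (e/6) p5 (- t) hf dirset_Y h2
  ltac:(rewrite -/p1 -/p2 -/p3 -/p4 -/p5 normrN in d1 d2 d3 d4 d5 *; lra).
rewrite -/p1 -/p2 -/p3 -/p4 -/p5 !normrN.
move: (f A) (f p1) (f p2) (f p3) (f p4) (f p5) (f (hline p5 _ _)) (Df dirX A) (Df dirY A).
move=> f0 f1 f2 f3 f4 f5 f6 X Y k6 k5 k4 k3 k2 k1.
have -> : f6 - f0 - (X * x + Y * y) = (f6 - f5 - Y * - t) + (f5 - f4 - X * - s)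
  + (f4 - f3 - Y * t) + (f3 - f2 - X * s) + (f2 - f1 - Y * y) + (f1 - f0 - X * x) by ring.
have bd (u : R) : `|u| <= rho -> e / 6 * `|u| <= e / 6 * rho by move=> ?; rewrite ler_pM2l.
have := bd _ hx; have := bd _ hy; have := bd _ hs; have := bd _ ht.
move: k1 k2 k3 k4 k5 k6; rewrite !ler_norml.
move=> /andP[? ?] /andP[? ?] /andP[? ?] /andP[? ?] /andP[? ?] /andP[? ?] ? ? ? ?.
by apply/andP; split; lra.
Qed.

End taylor.

(** * From horizontal partial derivatives to C^1_H maps *)

Section pairs.
Context {R : realType}.
Implicit Types (A B C p q : heis R) (f g : heis R -> R) (v : R * R).

Lemma enorm_le (p : R * R) : enorm p <= `|p.1| + `|p.2|.
Proof.
rewrite /enorm -[leRHS]ger0_norm ?addr_ge0// -sqrtr_sqr ler_sqrt ?sqr_ge0//.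
rewrite sqrrD !real_normK ?num_real//.
by rewrite lerD2r lerDl mulrn_wge0// mulr_ge0.
Qed.

Lemma enorm_ge1 (p : R * R) : `|p.1| <= enorm p.
Proof. by rewrite -sqrtr_sqr ler_sqrt ?addr_ge0 ?sqr_ge0// lerDl sqr_ge0. Qed.

Lemma enorm_ge2 (p : R * R) : `|p.2| <= enorm p.
Proof. by rewrite -sqrtr_sqr ler_sqrt ?addr_ge0 ?sqr_ge0// lerDr sqr_ge0. Qed.

Lemma continuous_heis_x : continuous (fun A : heis R => A.1.1).
Proof.
move=> A; apply/cvg_heisP => e e0; exists e => // B; apply: le_trans.
by rewrite -mulV_x; exact: rho_x.
Qed.

Lemma continuous_heis_y : continuous (fun A : heis R => A.1.2).
Proof.
move=> A; apply/cvg_heisP => e e0; exists e => // B; apply: le_trans.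
by rewrite -mulV_y; exact: rho_y.
Qed.

Lemma continuous_heis_z : continuous (fun A : heis R => A.2).
Proof. by move=> A; exact: (@cvg_snd _ _ (nbhs A.1) (nbhs A.2)). Qed.

Definition hmap (a b c d : R) : heis R -> R * R :=
  fun B => (a * B.1.1 + b * B.1.2, c * B.1.1 + d * B.1.2).

Lemma hmap_homogeneous_hom a b c d : homogeneous_hom (hmap a b c d).
Proof.
split.
- have lin u w : continuous (fun B : heis R => u * B.1.1 + w * B.1.2).
    move=> A; apply: cvgD; apply: cvgM;
    (exact: cvg_cst || exact: continuous_heis_x || exact: continuous_heis_y).
  by move=> A; apply: (cvg_pair (lin a b A) (lin c d A)).
- by case=> [[x y] z] [[x' y'] z']; congr (_, _) => /=; ring.
- by move=> t [[x y] z] _; congr (_, _) => /=; rewrite /GRing.scale /=; ring.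
Qed.

Lemma rho_dil (t : R) B : 0 < t -> rho_infty (heis_dil t B) <= t * rho_infty B.
Proof.
move=> t0; rewrite rho_leE ?mulr_ge0 ?rho_ge0 ?(ltW t0)//.
have := rho_proj B; have := rho_z B.
case: B => [[x y] z] /= hz hp; rewrite normrM ger0_norm ?sqr_ge0// !exprMn.
by rewrite -mulrDr !ler_pM2l ?exprn_gt0// hz hp.
Qed.

(** Homogeneity transports the estimate at the small point [heis_dil t B] back to [B]: the factor
    [t] cancels, so [L B] and [L' B] differ by at most [e * rho_infty B] for every [e]. *)
Lemma is_hderiv_unique (F : heis R -> R * R) A L L' :
  is_hderiv F A L -> is_hderiv F A L' -> L = L'.
Proof.
move=> [[_ _ hL] dL] [[_ _ hL'] dL']; apply/funext => B.
have key (e : R) : 0 < e -> `|(L B).1 - (L' B).1| <= e * rho_infty B /\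
                            `|(L B).2 - (L' B).2| <= e * rho_infty B.
  move=> e0; have e4 : 0 < e / 2 by rewrite divr_gt0.
  have /near_heisP[r r0 hr] := dL _ e4.
  have /near_heisP[r' r'0 hr'] := dL' _ e4.
  pose m := Num.min r r'; have m0 : 0 < m by rewrite lt_min r0.
  (* This brings [heis_dil t B] into both neighbourhoods; the added 1 covers [rho_infty B = 0]. *)
  pose t := m / (1 + rho_infty B).
  have B0 : 0 < 1 + rho_infty B by rewrite ltr_wpDr ?rho_ge0.
  have t0 : 0 < t by rewrite divr_gt0.
  have tB : t * rho_infty B <= m.
    by rewrite -mulrAC ler_pdivrMr// ler_pM2l// lerDr.
  have ct : d_infty (heis_dil t B) 1%g <= m.
    by rewrite /d_infty invg1 mul1g; apply: le_trans (rho_dil _ t0) tB.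
  move: ct; rewrite le_min => /andP[/hr c1 /hr' c2].
  rewrite hL// in c1; rewrite hL'// in c2.
  have dt : e / 2 * rho_infty (heis_dil t B) <= e / 2 * (t * rho_infty B).
    by rewrite ler_pM2l// rho_dil.
  have comp (u l l' : R) : `|u - t * l| <= e / 2 * (t * rho_infty B) ->
      `|u - t * l'| <= e / 2 * (t * rho_infty B) -> `|l - l'| <= e * rho_infty B.
    move=> h h'; rewrite -(ler_pM2l t0) -{1}(gtr0_norm t0) -normrM.
    have -> : t * (l - l') = (u - t * l') - (u - t * l) by ring.
    apply: le_trans (ler_normB _ _) _; lra.
  split.
    exact: comp (le_trans (enorm_ge1 _) (le_trans c1 dt)) (le_trans (enorm_ge1 _) (le_trans c2 dt)).
  exact: comp (le_trans (enorm_ge2 _) (le_trans c1 dt)) (le_trans (enorm_ge2 _) (le_trans c2 dt)).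
have eq0 (a b : R) : (forall e, 0 < e -> `|a - b| <= e * rho_infty B) -> a = b.
  move=> h; apply/eqP; rewrite -subr_eq0 -normr_le0; apply/ler_addgt0Pr => e e0.
  have B0 : 0 < 1 + rho_infty B by rewrite ltr_wpDr ?rho_ge0.
  apply: le_trans (h (e / (1 + rho_infty B)) _) _; first by rewrite divr_gt0.
  by rewrite add0r mulrAC ler_pdivrMr// ler_pM2l// lerDr.
rewrite [LHS]surjective_pairing [RHS]surjective_pairing.
by congr (_, _); apply: eq0 => e /key[].
Qed.

Lemma hC1_is_hderiv f g Df Dg A : hC1 f Df -> hC1 g Dg ->
  is_hderiv (fun A => (f A, g A)) A
    (hmap (Df dirX A) (Df dirY A) (Dg dirX A) (Dg dirY A)).
Proof.
move=> hf hg; split; first exact: hmap_homogeneous_hom.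
move=> e e0; have e2 : 0 < e / 2 by rewrite divr_gt0.
apply: filterS2 (hC1_taylor A hf e2) (hC1_taylor A hg e2) => B h1 h2.
apply: le_trans (enorm_le _) _; rewrite [e]splitr mulrDl.
exact: lerD h1 h2.
Qed.

Lemma hC1_Dh f g Df Dg A : hC1 f Df -> hC1 g Dg ->
  Dh (fun A => (f A, g A)) A =
  hmap (Df dirX A) (Df dirY A) (Dg dirX A) (Dg dirY A).
Proof.
move=> hf hg; have h := hC1_is_hderiv A hf hg.
apply: (is_hderiv_unique _ h).
exact: (@xgetPex _ (fun=> 0) [set L | is_hderiv _ A L] (ex_intro _ _ h)).
Qed.

Lemma hC1_C1H f g Df Dg : hC1 f Df -> hC1 g Dg -> C1H (fun A => (f A, g A)).
Proof.
move=> hf hg; split.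
  by move=> A; eexists; exact: hC1_is_hderiv hf hg.
(* One quarter for each of the four partial derivatives, as the coordinates of [B] are at most
   one. *)
move=> A e e0; have e4 : 0 < e / 4 by rewrite divr_gt0.
have near_D h Dh' v : hC1 h Dh' -> dirset v ->
    \forall A' \near A, `|Dh' v A' - Dh' v A| <= e / 4.
  move=> [_ hh] /hh[ch _]; have [r r0 hr] := (cvg_heisP _ _).1 (ch A) _ e4.
  by apply/near_heisP; exists r.
near=> A' => B B1; rewrite !(hC1_Dh _ hf hg).
apply: le_trans (enorm_le _) _ => /=.
have x1 : `|B.1.1| <= 1 := le_trans (rho_x B) B1.
have y1 : `|B.1.2| <= 1 := le_trans (rho_y B) B1.
have comp (a b a' b' : R) : `|a' - a| <= e / 4 -> `|b' - b| <= e / 4 ->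
    `|a' * B.1.1 + b' * B.1.2 - (a * B.1.1 + b * B.1.2)| <= e / 2.
  move=> ha hb.
  have -> : a' * B.1.1 + b' * B.1.2 - (a * B.1.1 + b * B.1.2) =
    (a' - a) * B.1.1 + (b' - b) * B.1.2 by ring.
  apply: le_trans (ler_normD _ _) _; rewrite !normrM.
  have := ler_pM (normr_ge0 _) (normr_ge0 _) ha x1.
  have := ler_pM (normr_ge0 _) (normr_ge0 _) hb y1; lra.
rewrite [e]splitr; apply: lerD; apply: comp; near: A';
  by apply: near_D; (exact: hf || exact: hg || exact: dirset_X || exact: dirset_Y).
Unshelve. all: by end_near. Qed.

End pairs.

(** * Nets with bounded overlap *)

Section nets.
Context {R : realType}.
Implicit Types (A B C p q : heis R).

Definition spaced (r : R) (s : seq (heis R)) : Prop :=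
  {in s &, forall q q', q != q' -> r < d_infty q q'}.

(** Greedy selection: a point is kept only if it is farther than [r] from all points kept so far,
    and a dropped point is covered by the one that excluded it. *)
Lemma thinning (r : R) (s : seq (heis R)) : 0 <= r -> exists t : seq (heis R),
  [/\ uniq t, {subset t <= s}, spaced r t &
      forall q, q \in s -> exists2 q', q' \in t & d_infty q q' <= r].
Proof.
move=> r0; elim: s => [|q s [t [ut ts st cov]]]; first by exists [::].
have [[q' q't qq']|far] := pselect (exists2 q', q' \in t & d_infty q q' <= r).
  exists t; split => //.
    by move=> x /ts xs; rewrite inE xs orbT.
  by move=> x; rewrite inE => /orP[/eqP ->|/cov//]; exists q'.
have qt q' : q' \in t -> r < d_infty q q'.
  by move=> q't; rewrite ltNge; apply/negP => h; apply: far; exists q'.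
exists (q :: t); split.
- rewrite /= ut andbT; apply/negP => /qt; by rewrite dxx ltNge r0.
- by move=> x; rewrite !inE => /orP[->//|/ts ->]; rewrite orbT.
- move=> x y; rewrite !inE => /orP[/eqP ->|xt] /orP[/eqP ->|yt].
  + by rewrite eqxx.
  + by move=> _; exact: qt.
  + by move=> _; rewrite dC; exact: qt.
  + exact: st.
- move=> x; rewrite inE => /orP[/eqP ->|/cov[q' q't h]].
    by exists q; rewrite ?mem_head// dxx.
  by exists q' => //; rewrite inE q't orbT.
Qed.

Lemma spaced_net (K : set (heis R)) (r : R) : compact K -> 0 < r ->
  exists s : seq (heis R), [/\ uniq s, forall q, q \in s -> K q,
    spaced r s & forall A, K A -> exists2 q, q \in s & d_infty A q <= 2 * r].
Proof.
move=> cK r0; have [s [sK covs]] := compact_finite_net cK r0.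
have [t [ut ts st covt]] := thinning s (ltW r0).
exists t; split => //; first by move=> q /ts /sK.
move=> A /covs[q qs Aq]; have [q' q't qq'] := covt q qs; exists q' => //.
by apply: le_trans (d_triangle q _ _) _; rewrite mulr_natl mulr2n lerD.
Qed.

(** The bounds by [k] ensure that [inord] leaves the truncations unchanged, so equal cells mean
    equal integer parts. *)
Lemma inord_truncn_dist (k : nat) (u u' : R) : 0 <= u <= k%:R -> 0 <= u' <= k%:R ->
  inord (Num.truncn u) = inord (Num.truncn u') :> 'I_k.+1 -> `|u - u'| < 1.
Proof.
move=> /andP[u0 uk] /andP[u0' uk'] /(congr1 (@nat_of_ord _)).
have lt (w : R) : w <= k%:R -> (Num.truncn w < k.+1)%N.
  by move=> h; rewrite ltnS Num.Theory.truncn_le_nat -natr1; lra.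
rewrite !inordK ?lt// => e.
have := Num.Theory.truncn_itv u0; have := Num.Theory.truncn_itv u0'.
rewrite e -natr1 => /andP[h1 h2] /andP[h3 h4].
by rewrite ltr_norml; apply/andP; split; lra.
Qed.

(** Cells have side [1 / 20]. In the vertical coordinate of the group difference the cross terms
    with [a'] and [b'] add at most [4 / 5], so the total stays below one. *)
Lemma cell_small (a b c a' b' c' : R) :
  `|20 * (a + 4) - 20 * (a' + 4)| < 1 -> `|20 * (b + 4) - 20 * (b' + 4)| < 1 ->
  `|20 * (c + 16) - 20 * (c' + 16)| < 1 -> `|a'| <= 4 -> `|b'| <= 4 ->
  (a - a') ^+ 2 + (b - b') ^+ 2 <= 1 /\
  `|c - c' - 2 * ((a - a') * b') + 2 * ((b - b') * a')| <= 1.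
Proof.
rewrite -!mulrBr => da db dc ha hb.
have {}da : `|a - a'| <= 1 / 20.
  by move: da; rewrite ltr_norml ler_norml => /andP[? ?]; apply/andP; split; lra.
have {}db : `|b - b'| <= 1 / 20.
  by move: db; rewrite ltr_norml ler_norml => /andP[? ?]; apply/andP; split; lra.
have sm (u t : R) : `|u| <= 1 / 20 -> `|t| <= 4 -> `|u * t| <= 1 / 5.
  by move=> hu ht; rewrite normrM; have := ler_pM (normr_ge0 _) (normr_ge0 _) hu ht; lra.
have sq (u : R) : `|u| <= 1 / 20 -> u ^+ 2 <= 1 / 2.
  move=> hu; have h4 : `|u| <= 4 by lra.
  by have := sm u u hu h4; rewrite -expr2 ger0_norm ?sqr_ge0//; lra.
split; first by have := sq _ da; have := sq _ db; lra.
have := sm _ _ da hb; have := sm _ _ db ha; move: dc; rewrite ltr_norml !ler_norml.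
by move=> /andP[? ?] /andP[? ?] /andP[? ?]; apply/andP; split; lra.
Qed.

(* Rescaled and translated to [p], the ball of radius [4r] is cut into cells
   of diameter less than one, each containing at most one point. *)
Lemma spaced_count : exists M : nat, forall (r : R) (s : seq (heis R)) p,
  0 < r -> uniq s -> spaced r s ->
  (size [seq q <- s | (d_infty q p <= 4 * r)%R] <= M)%N.
Proof.
(* The vertical coordinate has the widest range: its modulus is at most 16 after rescaling, and
   [20 * (16 + 16) = 640]. *)
have [k hk] : exists k : nat, k%:R = 640 :> R by exists 640.
exists #|{: 'I_k.+1 * 'I_k.+1 * 'I_k.+1}| => r s p r0 us ss.
pose l := [seq q <- s | (d_infty q p <= 4 * r)%R]; rewrite -/l.
pose w q := (p^-1 * q)%g.
pose cx q := 20 * ((w q).1.1 / r + 4).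
pose cy q := 20 * ((w q).1.2 / r + 4).
pose cz q := 20 * ((w q).2 / r ^+ 2 + 16).
pose c q : 'I_k.+1 * 'I_k.+1 * 'I_k.+1 :=
  (inord (Num.truncn (cx q)), inord (Num.truncn (cy q)), inord (Num.truncn (cz q))).
have r2 : 0 < r ^+ 2 by rewrite exprn_gt0.
have bd q : q \in l -> [/\ `|(w q).1.1 / r| <= 4, `|(w q).1.2 / r| <= 4 &
    `|(w q).2 / r ^+ 2| <= 16].
  rewrite mem_filter => /andP[h _].
  rewrite !normrM !normfV (gtr0_norm r0) (gtr0_norm r2) !ler_pdivrMr//.
  split.
  - exact: le_trans (rho_x _) h.
  - exact: le_trans (rho_y _) h.
  - apply: le_trans (rho_z _) _.
    have -> : 16 * r ^+ 2 = (4 * r) ^+ 2 by ring.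
    by rewrite ler_sqr ?nnegrE ?rho_ge0 ?mulr_ge0 ?(ltW r0)//; exact: h.
have bc q : q \in l -> [/\ 0 <= cx q <= k%:R, 0 <= cy q <= k%:R & 0 <= cz q <= k%:R].
  by rewrite hk => /bd[]; rewrite !ler_norml /cx /cy /cz => /andP[? ?] /andP[? ?] /andP[? ?];
   split; apply/andP; split; lra.
have injc : {in l &, injective c}.
  move=> q q' ql q'l [ex ey ez]; apply/eqP; apply: contraT => qq'.
  have [bx by_ bz] := bc _ ql; have [bx' by' bz'] := bc _ q'l.
  have dx := inord_truncn_dist bx bx' ex.
  have dy := inord_truncn_dist by_ by' ey.
  have dz := inord_truncn_dist bz bz' ez.
  have := ss q q'; move: (ql) (q'l); rewrite !mem_filter => /andP[_ qs] /andP[_ q's].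
  move=> /(_ qs q's qq'); rewrite ltNge => /negP; case.
  have -> : d_infty q q' = rho_infty ((w q')^-1 * w q)%g.
    by rewrite /w invgM invgK -mulgA mulVKg.
  have [hx hy _] := bd _ ql; have [hx' hy' _] := bd _ q'l.
  rewrite rho_leE ?(ltW r0)// mulV_x mulV_y mulV_z.
  move: dx dy dz hx hy hx' hy'; rewrite /cx /cy /cz.
  move: (w q) (w q') => [[x y] z] [[x' y'] z'] /=.
  have ex1 (t : R) : t = t / r * r by rewrite divfK ?gt_eqF.
  have ez1 (t : R) : t = t / r ^+ 2 * r ^+ 2 by rewrite divfK ?gt_eqF.
  have := ex1 x; have := ex1 y; have := ez1 z; have := ex1 x'; have := ex1 y'; have := ez1 z'.
  move: (x / r) (y / r) (z / _) (x' / r) (y' / r) (z' / _) => a b c0 a' b' c0'.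
  move=> -> -> -> -> -> -> dx dy dz ? ? ha hb.
  have [h1 h2] := cell_small dx dy dz ha hb.
  have -> : (a * r - a' * r) ^+ 2 + (b * r - b' * r) ^+ 2 =
    ((a - a') ^+ 2 + (b - b') ^+ 2) * r ^+ 2 by ring.
  have -> : c0 * r ^+ 2 - c0' * r ^+ 2 - 2 * (a * r - a' * r) * (b' * r) +
    2 * (a' * r) * (b * r - b' * r) =
    (c0 - c0' - 2 * ((a - a') * b') + 2 * ((b - b') * a')) * r ^+ 2 by ring.
  rewrite normrM (gtr0_norm r2) -[X in _ <= X]mul1r -[X in _ && (_ <= X)]mul1r.
  by rewrite !ler_pM2r// h1 h2.
rewrite -(size_map c) -(card_uniqP _); last by rewrite map_inj_in_uniq// filter_uniq.
exact: max_card.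
Qed.

End nets.

(** * Cutoff functions *)

Section bumps.
Context {R : realType}.
Implicit Types (A B C p q : heis R) (f g : heis R -> R) (v : R * R).

(** Used in particular for the extension at points of [K], where differentiability is known only
    through a growth estimate. *)
Lemma is_derive_littleo (h : R -> R) (x a : R) :
  (forall e : R, 0 < e -> exists2 r : R, 0 < r &
    forall t : R, `|t| <= r -> `|h (x + t) - h x - a * t| <= e * `|t|) ->
  is_derive x (1 : R) h a.
Proof.
move=> ho.
have cv : (fun t : R => t^-1 *: (h (t *: (1 : R) + x) - h x)) @ 0^' --> a.
  apply/cvgrPdist_le => e /ho[r r0 hr]; near=> t.
  have t0 : t != 0 by near: t; exact: nbhs_dnbhs_neq.
  have tr : `|t| <= r.
    near: t; exists r => // t /=; rewrite sub0r normrN => /ltW //.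
  have := hr t tr; rewrite /GRing.scale /= mulr1 [t + x]addrC.
  rewrite distrC => {}hr.
  have -> : a - t^-1 * (h (x + t) - h x) = (a * t - (h (x + t) - h x)) / t by field.
  by rewrite normrM normfV ler_pdivrMr ?normr_gt0.
by apply: DeriveDef; [apply: cvgP cv | apply: cvg_lim cv].
Unshelve. all: by end_near. Qed.

Definition sqrpos (t : R) : R := Num.max 0 t ^+ 2.

Lemma sqrpos_ge0 t : 0 <= sqrpos t. Proof. exact: sqr_ge0. Qed.

Lemma is_derive_sqrpos (t : R) : is_derive t (1 : R) sqrpos (2 * Num.max 0 t).
Proof.
apply: is_derive_littleo => e e0; exists e => // s se; rewrite /sqrpos.
apply: (@le_trans _ _ (s ^+ 2)); last first.
  by rewrite -real_normK ?num_real// expr2 ler_wpM2r.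
rewrite ler_norml.
have := sqr_ge0 s; case: (leP 0 (t + s)) => h; case: (leP 0 t) => h' hs;
  apply/andP; split; nra.
Qed.

Lemma continuous_max0 : continuous (fun t : R => Num.max 0 t).
Proof.
move=> t; apply/cvgrPdist_le => e e0; near=> s.
have : `|t - s| <= e.
  by near: s; exists e => // s /= /ltW.
rewrite !ler_norml => /andP[? ?].
by case: (leP 0 t) => ?; case: (leP 0 s) => ?; apply/andP; split; lra.
Unshelve. all: by end_near. Qed.

Lemma continuous_dsqrpos : continuous (fun t : R => 2 * Num.max 0 t).
Proof. by move=> t; apply: cvgM; [exact: cvg_cst|exact: continuous_max0]. Qed.

(* A C^1 function on the line agreeing with [s^-1] for [1 <= s]. *)
Definition cinv (s : R) : R := (s + sqrpos (1 - s))^-1.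

Definition dcinv (s : R) : R :=
  (2 * Num.max 0 (1 - s) - 1) / (s + sqrpos (1 - s)) ^+ 2.

(** For [s <= 1] the sum is [(s - 1 / 2) ^+ 2 + 3 / 4], and beyond that it is [s]. Hence [cinv] is
    differentiable on the whole line and bounded. *)
Lemma cinv_den s : 1 / 2 <= s + sqrpos (1 - s).
Proof. by rewrite /sqrpos; have := sqr_ge0 (s - 1 / 2); case: (leP 0 (1 - s)) => h h2; nra. Qed.

Lemma cinvE s : 1 <= s -> s * cinv s = 1.
Proof.
move=> s1; rewrite /cinv /sqrpos max_l ?subr_le0// expr0n addr0 divff//.
by rewrite gt_eqF// (lt_le_trans ltr01).
Qed.

Lemma cinv_bound s : 0 <= cinv s <= 2.
Proof.
have h := cinv_den s; have h0 : 0 < s + sqrpos (1 - s) by lra.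
by rewrite /cinv invr_ge0 (ltW h0) /= -[X in X <= _]mul1r ler_pdivrMr//; lra.
Qed.

Lemma dcinv_bound s : 0 <= s -> `|dcinv s| <= 4.
Proof.
move=> s0; have h := cinv_den s; have h0 : 0 < s + sqrpos (1 - s) by lra.
rewrite /dcinv normrM normfV (gtr0_norm (exprn_gt0 _ h0)) ler_pdivrMr ?exprn_gt0//.
apply: (@le_trans _ _ 1); last by move: h; move: (s + _) => u h; nra.
by rewrite ler_norml; case: (leP 0 (1 - s)) => h'; apply/andP; split; lra.
Qed.

Lemma is_derive_cinv (s : R) : is_derive s (1 : R) cinv (dcinv s).
Proof.
have h : s + sqrpos (1 - s) != 0 by rewrite gt_eqF//; have := cinv_den s; lra.
have d1 : is_derive s (1 : R) (fun s => 1 - s) (-1).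
  by rewrite -[X in is_derive _ _ _ X]add0r; apply: is_deriveB.
have d2 := @is_derive1_comp _ sqrpos (fun s => 1 - s) s _ _ (is_derive_sqrpos (1 - s)) d1.
have d3 := @is_deriveD _ _ _ id _ _ _ _ _ (is_derive_id s 1) d2.
have := @is_deriveV _ (fun s => s + sqrpos (1 - s)) s _ _ h d3.
rewrite (_ : _ *: _ = dcinv s)// /dcinv /GRing.scale /=; field; exact: h.
Qed.

Lemma continuous_dcinv : continuous dcinv.
Proof.
move=> s; have h : s + sqrpos (1 - s) != 0 by rewrite gt_eqF//; have := cinv_den s; lra.
have c1 : {for s, continuous (fun s : R => 1 - s)}.
  by apply: cvgB; [exact: cvg_cst|exact: cvg_id].
have c2 : {for s, continuous (fun s : R => Num.max 0 (1 - s))}.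
  apply: (@cvg_comp _ _ _ (fun s : R => 1 - s) (fun t : R => Num.max 0 t)
    _ (nbhs (1 - s))); [exact: c1 | exact: continuous_max0].
apply: cvgM.
  apply: cvgB; last exact: cvg_cst.
  by apply: cvgM => //; exact: cvg_cst.
apply: cvgV; first by rewrite expf_neq0.
have c3 : {for s, continuous (fun s : R => s + sqrpos (1 - s))}.
  apply: cvgD; first exact: cvg_id.
  by rewrite /sqrpos; under eq_fun do rewrite expr2; apply: cvgM.
by under eq_fun do rewrite expr2; apply: cvgM.
Qed.

End bumps.

(** * Cutoffs built from a polynomial gauge *)

Section gauge.
Context {R : realType}.
Implicit Types (A B C p q : heis R) (f g : heis R -> R) (v : R * R).

Lemma hC1_eq f g Df Dg : hC1 f Df -> f =1 g -> (forall v, Df v =1 Dg v) -> hC1 g Dg.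
Proof.
move=> hf /funext <- e; rewrite (_ : Dg = Df)//.
by apply/funext => v; apply/funext => A; rewrite e.
Qed.

Lemma is_derive_affine (a b x : R) : is_derive x (1 : R) (fun t => a + t * b) b.
Proof.
apply: is_derive_littleo => e e0; exists 1 => // t _.
rewrite (_ : _ - _ - _ = 0); last by ring.
by rewrite normr0 mulr_ge0// ltW.
Qed.

Lemma hC1_x : hC1 (fun A : heis R => A.1.1) (fun v _ => v.1).
Proof.
split; first exact: continuous_heis_x.
move=> v _; split; first by move=> ?; exact: cvg_cst.
move=> A; rewrite /hder; under eq_fun do rewrite hlineE /=.
exact: is_derive_affine.
Qed.

Lemma hC1_y : hC1 (fun A : heis R => A.1.2) (fun v _ => v.2).
Proof.
split; first exact: continuous_heis_y.
move=> v _; split; first by move=> ?; exact: cvg_cst.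
move=> A; rewrite /hder; under eq_fun do rewrite hlineE /=.
exact: is_derive_affine.
Qed.

Lemma hC1_z : hC1 (fun A : heis R => A.2)
  (fun v A => 2 * v.1 * A.1.2 - 2 * v.2 * A.1.1).
Proof.
split; first exact: continuous_heis_z.
move=> v _; split.
  move=> A; apply: cvgB; apply: cvgM;
  (exact: cvg_cst || exact: continuous_heis_x || exact: continuous_heis_y).
move=> A; rewrite /hder; under eq_fun do rewrite hlineE /=.
rewrite (_ : (fun _ => _) = fun t => A.2 + t * (2 * v.1 * A.1.2 - 2 * v.2 * A.1.1)).
  exact: is_derive_affine.
by apply/funext => t; ring.
Qed.

Lemma continuous_translate q g : continuous g -> continuous (fun p => g (q * p)%g).
Proof.
move=> cg p; apply/cvg_heisP => e e0.
have [r r0 hr] := (cvg_heisP _ _).1 (cg (q * p)%g) _ e0.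
exists r => // B Bp; apply: hr.
by rewrite /d_infty invgM -mulgA mulKg.
Qed.

Lemma hC1_translate q f Df : hC1 f Df ->
  hC1 (fun p => f (q * p)%g) (fun v p => Df v (q * p)%g).
Proof.
move=> [cf hf]; split; first exact: continuous_translate.
move=> v /hf[cD dD]; split; first exact: continuous_translate.
move=> A; rewrite /hder; under eq_fun do rewrite hlineM.
exact: dD.
Qed.

(** The fourth power of the Koranyi gauge. Unlike [rho_infty] it is a polynomial, hence smooth, and
    it is comparable to [rho_infty A ^+ 4] within a factor 2. *)
Definition gauge4 A : R := (A.1.1 ^+ 2 + A.1.2 ^+ 2) ^+ 2 + A.2 ^+ 2.

Definition Dgauge4 v A : R :=
  4 * (A.1.1 ^+ 2 + A.1.2 ^+ 2) * (A.1.1 * v.1 + A.1.2 * v.2) +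
  4 * A.2 * (v.1 * A.1.2 - v.2 * A.1.1).

Lemma hC1_gauge4 : hC1 gauge4 Dgauge4.
Proof.
have hp := hC1D (hC1M hC1_x hC1_x) (hC1M hC1_y hC1_y).
apply: (hC1_eq (hC1D (hC1M hp hp) (hC1M hC1_z hC1_z))) => [A|v A];
  by rewrite /gauge4 /Dgauge4; ring.
Qed.

Lemma gauge4_ge A : rho_infty A ^+ 4 <= gauge4 A.
Proof.
have r0 := rho_ge0 A; rewrite /gauge4 /rho_infty; case: (leP (enorm _)) => _.
  have -> : Num.sqrt `|A.2| ^+ 4 = (Num.sqrt `|A.2| ^+ 2) ^+ 2 by ring.
  by rewrite sqr_sqrtr// real_normK ?num_real// lerDr sqr_ge0.
rewrite /enorm /heis_proj; set w := _ + _.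
have -> : Num.sqrt w ^+ 4 = (Num.sqrt w ^+ 2) ^+ 2 by ring.
by rewrite sqr_sqrtr ?addr_ge0 ?sqr_ge0// lerDl sqr_ge0.
Qed.

Lemma gauge4_le A : gauge4 A <= 2 * rho_infty A ^+ 4.
Proof.
have h1 := rho_proj A; have h2 := rho_z A; rewrite /gauge4.
have -> : 2 * rho_infty A ^+ 4 = (rho_infty A ^+ 2) ^+ 2 + (rho_infty A ^+ 2) ^+ 2 by ring.
rewrite -[A.2 ^+ 2]real_normK ?num_real//.
by apply: lerD; rewrite ler_sqr ?nnegrE ?sqr_ge0// addr_ge0 ?sqr_ge0.
Qed.

Lemma Dgauge4_le v A : dirset v -> `|Dgauge4 v A| <= 16 * rho_infty A ^+ 3.
Proof.
move=> [v1 v2]; have hp := rho_proj A; have hz := rho_z A.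
have hx := rho_x A; have hy := rho_y A; have r0 := rho_ge0 A.
have w0 : 0 <= A.1.1 ^+ 2 + A.1.2 ^+ 2 by rewrite addr_ge0 ?sqr_ge0.
have l1 : `|A.1.1 * v.1 + A.1.2 * v.2| <= 2 * rho_infty A.
  apply: le_trans (ler_normD _ _) _; rewrite !normrM.
  have := ler_pM (normr_ge0 _) (normr_ge0 _) hx v1.
  have := ler_pM (normr_ge0 _) (normr_ge0 _) hy v2; lra.
have l2 : `|v.1 * A.1.2 - v.2 * A.1.1| <= 2 * rho_infty A.
  apply: le_trans (ler_normB _ _) _; rewrite !normrM.
  have := ler_pM (normr_ge0 _) (normr_ge0 _) v1 hy.
  have := ler_pM (normr_ge0 _) (normr_ge0 _) v2 hx; lra.
apply: le_trans (ler_normD _ _) _; rewrite !normrM (ger0_norm w0) (ger0_norm (ler0n R 4)).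
have e3 : rho_infty A ^+ 2 * (2 * rho_infty A) = 2 * rho_infty A ^+ 3 by ring.
have := ler_pM w0 (normr_ge0 _) hp l1; have := ler_pM (normr_ge0 _) (normr_ge0 _) hz l2.
rewrite e3; lra.
Qed.

(** The constant 163 lies above [162 = 2 * 3 ^+ 4] and below [256 = 4 ^+ 4]: the cutoff is at least
    one within [3 * r] of [q] and vanishes beyond [4 * r]. *)
Definition cutoff (r : R) q p : R := sqrpos (163 - gauge4 (q^-1 * p)%g / r ^+ 4).

Definition Dcutoff (r : R) q v p : R :=
  2 * Num.max 0 (163 - gauge4 (q^-1 * p)%g / r ^+ 4) *
  - (Dgauge4 v (q^-1 * p)%g / r ^+ 4).

Lemma hC1_cutoff r q : hC1 (cutoff r q) (Dcutoff r q).
Proof.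
have hg := hC1_translate q^-1%g hC1_gauge4.
have ha := hC1D (hC1_cst 163) (hC1M hg (hC1_cst (- r ^- 4))).
have := hC1_comp is_derive_sqrpos continuous_dsqrpos ha.
move=> /hC1_eq; apply => [A|v A] /=; first by rewrite /cutoff mulrN.
rewrite /Dcutoff; congr (2 * Num.max 0 _ * _); first by rewrite mulrN.
by rewrite mulr0 !add0r mulNr mulrC.
Qed.

Lemma cutoff_ge0 r q p : 0 <= cutoff r q p. Proof. exact: sqrpos_ge0. Qed.

Lemma cutoff_le r q p : 0 < r -> cutoff r q p <= 163 ^+ 2.
Proof.
move=> r0; have g0 : 0 <= gauge4 (q^-1 * p)%g / r ^+ 4.
  by rewrite divr_ge0 ?exprn_ge0 ?(ltW r0)// addr_ge0 ?sqr_ge0.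
rewrite /cutoff /sqrpos ler_sqr ?nnegrE ?le_max ?lexx// ge_max; lra.
Qed.

Lemma cutoff_far r q p : 0 < r -> 4 * r <= d_infty p q ->
  163 - gauge4 (q^-1 * p)%g / r ^+ 4 <= 0.
Proof.
move=> r0 h; have := gauge4_ge (q^-1 * p)%g; rewrite -/(d_infty p q).
rewrite subr_le0 ler_pdivlMr ?exprn_gt0//; apply: le_trans.
apply: (@le_trans _ _ ((4 * r) ^+ 4)).
  have := exprn_ge0 4 (ltW r0); have -> : (4 * r) ^+ 4 = 256 * r ^+ 4 by ring.
  lra.
by rewrite lerXn2r ?nnegrE ?d_ge0// mulr_ge0 ?(ltW r0).
Qed.

Lemma cutoff_eq0 r q p : 0 < r -> 4 * r <= d_infty p q -> cutoff r q p = 0.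
Proof. by move=> r0 /(cutoff_far r0) h; rewrite /cutoff /sqrpos max_l// expr0n. Qed.

Lemma Dcutoff_eq0 r q v p : 0 < r -> 4 * r <= d_infty p q -> Dcutoff r q v p = 0.
Proof. by move=> r0 /(cutoff_far r0) h; rewrite /Dcutoff max_l// mulr0 mul0r. Qed.

Lemma cutoff_ge1 r q p : 0 < r -> d_infty p q <= 3 * r -> 1 <= cutoff r q p.
Proof.
move=> r0 h; have h4 : gauge4 (q^-1 * p)%g <= 162 * r ^+ 4.
  apply: le_trans (gauge4_le _) _; rewrite -/(d_infty p q).
  have -> : 162 * r ^+ 4 = 2 * (3 * r) ^+ 4 by ring.
  by rewrite ler_pM2l// lerXn2r ?nnegrE ?d_ge0// mulr_ge0 ?(ltW r0).
rewrite -ler_pdivrMr ?exprn_gt0// in h4.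
rewrite /cutoff /sqrpos -[X in X <= _](expr1n _ 2) ler_sqr ?nnegrE ?le_max ?lexx//.
by apply/orP; right; lra.
Qed.

(** The factor [2 * 163] bounds the derivative of [sqrpos]; [16 * 64 / r] is the bound of
    [Dgauge4_le] at distance [4 * r], divided by [r ^+ 4]. *)
Lemma Dcutoff_le r q v p : 0 < r -> dirset v ->
  `|Dcutoff r q v p| <= (2 * 163 * (16 * 64)) / r.
Proof.
move=> r0 vd; have [h|h] := leP (4 * r) (d_infty p q).
  by rewrite Dcutoff_eq0// normr0 divr_ge0// (ltW r0).
have g0 : 0 <= gauge4 (q^-1 * p)%g / r ^+ 4.
  by rewrite divr_ge0 ?exprn_ge0 ?(ltW r0)// addr_ge0 ?sqr_ge0.
rewrite /Dcutoff -!mulrA normrM (ger0_norm (ler0n R 2)) ler_pM2l// normrM.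
apply: ler_pM => //.
  by rewrite ger0_norm ?le_max ?lexx// ge_max; lra.
rewrite normrN normrM normfV (gtr0_norm (exprn_gt0 4 r0)) ler_pdivrMr ?exprn_gt0//.
apply: le_trans (Dgauge4_le _ vd) _; rewrite -/(d_infty p q).
have -> : 16 * (64 / r) * r ^+ 4 = 16 * (4 * r) ^+ 3 by field; rewrite gt_eqF.
by rewrite ler_pM2l// lerXn2r ?nnegrE ?d_ge0 ?mulr_ge0 ?(ltW r0) ?(ltW h).
Qed.

End gauge.

(** * Averages over a net *)

Section averages.
Context {R : realType}.
Implicit Types (A B C p q : heis R) (f g w : heis R -> R) (v : R * R).
Implicit Types (r : R) (s : seq (heis R)).

Definition bsum r s w p : R := \sum_(q <- s) cutoff r q p * w q.

Definition Dbsum r s w v p : R := \sum_(q <- s) Dcutoff r q v p * w q.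

Lemma hC1_bsum r s w : hC1 (bsum r s w) (Dbsum r s w).
Proof.
apply: (@hC1_sum R _ s (fun q p => cutoff r q p * w q)
                (fun q v p => Dcutoff r q v p * w q)) => q.
apply: (hC1_eq (hC1M (hC1_cutoff r q) (hC1_cst (w q)))) => // v p.
by rewrite mulr0 add0r mulrC.
Qed.

Lemma sum_le_count (I : eqType) (t : seq I) (P : pred I) (F : I -> R) (c : R) (M : nat) :
  0 <= c -> (size [seq i <- t | P i] <= M)%N ->
  {in t, forall i, P i -> `|F i| <= c} -> {in t, forall i, ~~ P i -> F i = 0} ->
  `|\sum_(i <- t) F i| <= M%:R * c.
Proof.
move=> c0 hM h1 h0; apply: (@le_trans _ _ ((size [seq i <- t | P i])%:R * c)); last first.
  by rewrite ler_wpM2r// ler_nat.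
elim: t {hM} h1 h0 => [|i t ih] h1 h0 /=; first by rewrite big_nil normr0 mul0r.
have {}ih : `|\sum_(i <- t) F i| <= (size [seq i <- t | P i])%:R * c.
  by apply: ih => j jt; [apply: h1|apply: h0]; rewrite inE jt orbT.
rewrite big_cons; have [Pi|Pi] := boolP (P i).
  rewrite /= -nat1r mulrDl mul1r; apply: le_trans (ler_normD _ _) _.
  by rewrite lerD// h1// mem_head.
by rewrite h0 ?mem_head// add0r.
Qed.

(** Only net points within [4 * r] of [p] contribute, and [spaced_count] bounds their number
    independently of [r], [s] and [p]; so does the resulting [c]. *)
Lemma bsum_bounds : exists2 c : R, 0 <= c & forall r s p w (W : R), 0 < r -> uniq s ->
  spaced r s -> 0 <= W -> {in s, forall q, d_infty p q <= 4 * r -> `|w q| <= W} ->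
  `|bsum r s w p| <= c * W /\
  forall v, dirset v -> `|Dbsum r s w v p| <= c * W / r.
Proof.
have [M hM] := @spaced_count R.
pose b : R := 163 ^+ 2; pose d : R := 2 * 163 * (16 * 64).
have b0 : 0 <= b by rewrite exprn_ge0.
have d0 : 0 <= d by rewrite !mulr_ge0.
exists (M%:R * (b + d)); first by rewrite mulr_ge0// addr_ge0.
move=> r s p w W r0 us ss W0 hw; have ct := hM r s p r0 us ss.
have bd (F : heis R -> R) (e : R) : 0 <= e -> (forall q, `|F q| <= e) ->
    (forall q, 4 * r <= d_infty p q -> F q = 0) ->
    `|\sum_(q <- s) F q * w q| <= M%:R * (e * W).
  move=> e0 Fe F0; apply: sum_le_count ct _ _; first by rewrite mulr_ge0.
    by move=> q qs; rewrite dC => h; rewrite normrM ler_pM// hw.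
  by move=> q qs; rewrite -ltNge dC => /ltW/F0 ->; rewrite mul0r.
split=> [|v vd].
  apply: le_trans (bd (fun q => cutoff r q p) b b0 _ _) _.
  - by move=> q; rewrite ger0_norm ?cutoff_ge0// cutoff_le.
  - by move=> q; exact: cutoff_eq0.
  - by rewrite -mulrA ler_wpM2l// ler_wpM2r// lerDl.
apply: le_trans (bd (fun q => Dcutoff r q v p) (d / r) _ _ _) _.
- by rewrite divr_ge0// ltW.
- by move=> q; exact: Dcutoff_le.
- by move=> q; exact: Dcutoff_eq0.
- have -> : M%:R * (b + d) * W / r = M%:R * ((b + d) / r * W) by ring.
  by rewrite ler_wpM2l// ler_wpM2r// ler_wpM2r ?invr_ge0 ?(ltW r0)// lerDr.
Qed.

Lemma bsum1_ge0 r s p : 0 <= bsum r s (fun=> 1) p.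
Proof. by rewrite sumr_ge0// => q _; rewrite mulr1 cutoff_ge0. Qed.

(* The average of [w] over the points of [s] near [p] where the cutoffs add up to
   at least one, cut off to zero away from [s]. *)
Definition avg r s w p : R := bsum r s w p * cinv (bsum r s (fun=> 1) p).

Definition Davg r s w v p : R :=
  bsum r s w p * (dcinv (bsum r s (fun=> 1) p) * Dbsum r s (fun=> 1) v p) +
  cinv (bsum r s (fun=> 1) p) * Dbsum r s w v p.

Lemma hC1_avg r s w : hC1 (avg r s w) (Davg r s w).
Proof.
exact: hC1M (hC1_bsum r s w)
  (hC1_comp is_derive_cinv continuous_dcinv (hC1_bsum r s (fun=> 1))).
Qed.

(** Where the average of 1 equals one, this lets a constant be subtracted, so that only the
    oscillation of [w] counts. *)
Lemma avgB r s w (c : R) p :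
  avg r s (fun q => w q - c) p = avg r s w p - c * avg r s (fun=> 1) p.
Proof.
rewrite /avg mulrA -mulrBl; congr (_ * _).
rewrite /bsum mulr_sumr -sumrB; apply: eq_bigr => q _; ring.
Qed.

(** A single cutoff already makes the sum at least one, where [cinv] is the true inverse and the
    normalized cutoffs form a partition of unity. *)
Lemma avg_near r s p q : 0 < r -> q \in s -> d_infty p q <= 3 * r ->
  avg r s (fun=> 1) p = 1.
Proof.
move=> r0 qs h; rewrite /avg cinvE// /bsum (big_rem q)//= mulr1.
apply: le_trans (cutoff_ge1 r0 h) _; rewrite lerDl sumr_ge0// => q' _.
by rewrite mulr1 cutoff_ge0.
Qed.

Lemma avg_far r s w p : 0 < r -> {in s, forall q, 4 * r <= d_infty p q} ->
  avg r s w p = 0.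
Proof.
move=> r0 h; rewrite /avg /bsum big_seq big1 ?mul0r// => q /h dq.
by rewrite cutoff_eq0// mul0r.
Qed.

(** Product rule: [4 * c ^+ 2] comes from [dcinv] against two sums, [2 * c] from [cinv] against
    one. *)
Lemma avg_bounds : exists2 c : R, 0 <= c & forall r s p w (W : R), 0 < r -> uniq s ->
  spaced r s -> 0 <= W -> {in s, forall q, d_infty p q <= 4 * r -> `|w q| <= W} ->
  `|avg r s w p| <= c * W /\
  forall v, dirset v -> `|Davg r s w v p| <= c * W / r.
Proof.
have [c c0 hc] := bsum_bounds.
exists (4 * c ^+ 2 + 2 * c); first by rewrite addr_ge0 ?mulr_ge0 ?sqr_ge0.
move=> r s p w W r0 us ss W0 hw.
have [h1 h2] := hc r s p w W r0 us ss W0 hw.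
have [_ h3] := hc r s p (fun=> 1) 1 r0 us ss ler01 ltac:(by move=> ? ? ?; rewrite normr1).
have S0 := bsum1_ge0 r s p; have ds := dcinv_bound S0.
have /andP[k0 k2] := cinv_bound (bsum r s (fun=> 1) p).
have cW : 0 <= c * W by rewrite mulr_ge0.
split=> [|v vd].
  rewrite normrM (ger0_norm k0).
  have := ler_pM (normr_ge0 _) k0 h1 k2.
  have : 0 <= 4 * c ^+ 2 * W by rewrite !mulr_ge0 ?sqr_ge0.
  lra.
apply: le_trans (ler_normD _ _) _.
rewrite (normrM (bsum _ _ _ _)) (normrM (dcinv _)) (normrM (cinv _)) (ger0_norm k0).
have := ler_pM (normr_ge0 _) (mulr_ge0 (normr_ge0 _) (normr_ge0 _)) h1
  (ler_pM (normr_ge0 _) (normr_ge0 _) ds (h3 v vd)).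
have := ler_pM k0 (normr_ge0 _) k2 (h2 v vd).
have -> : (4 * c ^+ 2 + 2 * c) * W / r = c * W * (4 * (c * 1 / r)) + 2 * (c * W / r) by ring.
by move=> h4 h5; exact: lerD h5 h4.
Qed.

End averages.

(** * Whitney extension *)

Section whitney.
Context {R : realType}.
Context (K : set (heis R)) (u : heis R -> R) (net : nat -> seq (heis R)).
Implicit Types (A B C p q : heis R) (v : R * R).

(** With ratio 8 the distance [6 * scale n.+1] is [3 / 4 * scale n], which leaves a quarter of
    [scale n] for a neighbourhood in [ext_fluct]. *)
Definition scale (n : nat) : R := 8 ^- n.

Context (cK : compact K)
  (hu : forall e : R, 0 < e -> exists2 r : R, 0 < r &
    forall A B, K A -> K B -> d_infty A B <= r -> `|u A - u B| <= e * d_infty A B)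
  (hnet : forall n, [/\ uniq (net n), forall q, q \in net n -> K q,
    spaced (scale n) (net n) &
    forall A, K A -> exists2 q, q \in net n & d_infty A q <= 2 * scale n]).

Lemma scale_gt0 n : 0 < scale n.
Proof. by rewrite invr_gt0 exprn_gt0. Qed.

Lemma scaleS n : scale n = 8 * scale n.+1.
Proof. by rewrite /scale exprS invfM mulVKf. Qed.

Lemma scale_le m n : (m <= n)%N -> scale n <= scale m.
Proof.
move=> /subnK <-; elim: (n - m)%N => [//|k ih].
by apply: le_trans ih; rewrite addSn [leRHS]scaleS; have := scale_gt0 (k + m).+1; lra.
Qed.

Lemma scale_small (e : R) : 0 < e -> exists n, scale n <= e.
Proof.
move=> e0; exists (Num.truncn e^-1); rewrite /scale.
rewrite -[leRHS]invrK lef_pV2 ?posrE ?exprn_gt0 ?invr_gt0//.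
have ei : 0 <= e^-1 by rewrite invr_ge0 ltW.
have /andP[_ /ltW h] := Num.Theory.truncn_itv ei.
apply: le_trans h _; rewrite -natrX ler_nat.
by apply: ltn_expl.
Qed.

(** A lower bound on the distance to [K], stated pointwise so that an empty [K] is covered. *)
Definition far (c : R) n p := forall A, K A -> c * scale n <= d_infty p A.

(** The average of 1 is one near [K] and zero away from it. Each step thus installs the average at
    scale [m] near [K], keeps the earlier values away from [K], and blends the two in between. *)
Fixpoint stage n p : R :=
  if n is m.+1 then
    (1 - avg (scale m) (net m) (fun=> 1) p) * stage m p + avg (scale m) (net m) u p
  else 0.

Lemma stage_hC1 : exists D, forall n, hC1 (stage n) (D n).
Proof.
suff /choice[D hD] : forall n, exists D, hC1 (stage n) D by exists D.
elim=> [|n [D hD]].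
  by eexists; exact: hC1_cst.
eexists.
have h1 := hC1M (hC1_cst (-1)) (hC1_avg (scale n) (net n) (fun=> 1)).
apply: hC1_eq (hC1D (hC1M (hC1D (hC1_cst 1) h1) hD) (hC1_avg (scale n) (net n) u)) _ _ => //.
by move=> p /=; rewrite mulN1r.
Qed.

Lemma far_le c m n p : 0 <= c -> (m <= n)%N -> far c m p -> far c n p.
Proof.
by move=> c0 mn h A /h; apply: le_trans; rewrite ler_wpM2l// scale_le.
Qed.

Lemma far_notin c n p : 0 < c -> far c n p -> ~ K p.
Proof.
by move=> c0 h /h; rewrite dxx leNgt mulr_gt0// scale_gt0.
Qed.

Lemma notin_far c p : 0 < c -> ~ K p -> exists n, far c n p.
Proof.
move=> c0 /(compact_dist_gt0 cK)[s s0 hs].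
have [n hn] := scale_small (divr_gt0 s0 c0); exists n => A /hs; apply: le_trans.
by rewrite mulrC -ler_pdivlMr.
Qed.

Lemma far_near (c d : R) n p p' : far c n p -> d_infty p' p <= d * scale n ->
  far (c - d) n p'.
Proof.
move=> h dp A /h hA; have := d_triangle p' p A; rewrite mulrBl dC in dp *; lra.
Qed.

(** Beyond [4 * scale m] from [K] all averages at scale [m] or finer vanish, so the recursion no
    longer changes the value. *)
Lemma stage_stable m n p : (m <= n)%N -> far 4 m p -> stage n p = stage m p.
Proof.
move=> /subnK <-; elim: (n - m)%N => [//|k ih] fm.
have f0 w : avg (scale (k + m)) (net (k + m)) w p = 0.
  apply: avg_far; first exact: scale_gt0.
  move=> q qn; have [_ hK _ _] := hnet (k + m).
  exact: (far_le _ (leq_addl k m) fm) (hK _ qn).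
by rewrite addSn /= !f0 subr0 mul1r addr0 ih.
Qed.

(** Off [K] the stages are eventually constant; by [stage_stable] every index at which [p] is far
    gives the limit, whichever one [xget] picks. *)
Definition ext p : R := if `[< K p >] then u p else stage (xget 0%N (far 4 ^~ p)) p.

Lemma extK A : K A -> ext A = u A.
Proof. by move=> KA; rewrite /ext asboolT. Qed.

Lemma ext_far n p : far 4 n p -> ext p = stage n p.
Proof.
move=> h; rewrite /ext asboolF; last exact: far_notin h.
have : far 4 (xget 0%N (far 4 ^~ p)) p by exact: (@xgetPex _ 0%N (far 4 ^~ p) (ex_intro _ n h)).
move: (xget _ _) => m hm; rewrite -(stage_stable (leq_maxl m n) hm).
by rewrite -(stage_stable (leq_maxr m n) h).
Qed.

Lemma ext_near n p : far 5 n p -> \forall p' \near p, ext p' = stage n p'.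
Proof.
move=> h; apply/near_heisP; exists (scale n) => [|p' dp]; first exact: scale_gt0.
apply: ext_far; have -> : 4 = 5 - 1 :> R by ring.
by apply: far_near h _; rewrite mul1r.
Qed.

(** Some net point lies within [(1 + 2) * scale n] of [p], so the weight of [stage n] is zero and
    all coarser scales are forgotten. *)
Lemma stage_avg n p A : K A -> d_infty p A <= scale n ->
  stage n.+1 p = avg (scale n) (net n) u p /\ avg (scale n) (net n) (fun=> 1) p = 1.
Proof.
move=> KA pA; have [_ _ _ cov] := hnet n; have [q qn Aq] := cov _ KA.
have e1 : avg (scale n) (net n) (fun=> 1) p = 1.
  apply: avg_near qn _; first exact: scale_gt0.
  by apply: le_trans (d_triangle A _ _) _; lra.
by rewrite /= e1 subrr mul0r add0r.
Qed.

(* The correction to the constant [u A] at the two scales that matter near [p];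
   only the oscillation of [u] around [A] enters. *)
Definition fluct n A p : R :=
  (1 - avg (scale n.+1) (net n.+1) (fun=> 1) p) *
    avg (scale n) (net n) (fun q => u q - u A) p +
  avg (scale n.+1) (net n.+1) (fun q => u q - u A) p.

Definition Dfluct n A v p : R :=
  (1 - avg (scale n.+1) (net n.+1) (fun=> 1) p) *
    Davg (scale n) (net n) (fun q => u q - u A) v p +
  avg (scale n) (net n) (fun q => u q - u A) p *
    - Davg (scale n.+1) (net n.+1) (fun=> 1) v p +
  Davg (scale n.+1) (net n.+1) (fun q => u q - u A) v p.

Lemma hC1_fluct n A : hC1 (fun p => u A + fluct n A p) (Dfluct n A).
Proof.
have h1 := hC1M (hC1_cst (-1)) (hC1_avg (scale n.+1) (net n.+1) (fun=> 1)).
have h2 := hC1D (hC1M (hC1D (hC1_cst 1) h1)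
    (hC1_avg (scale n) (net n) (fun q => u q - u A)))
    (hC1_avg (scale n.+1) (net n.+1) (fun q => u q - u A)).
apply: hC1_eq (hC1D (hC1_cst (u A)) h2) _ _ => [p|v p].
  by rewrite /fluct mulN1r.
by rewrite /Dfluct; ring.
Qed.

(** Near [p] the extension is [stage n.+2], and [stage_avg] removes every scale coarser than [n];
    only two averages remain. *)
Lemma ext_fluct n p A : K A -> d_infty p A <= 3 / 4 * scale n -> far 5 n.+2 p ->
  \forall p' \near p, ext p' = u A + fluct n A p'.
Proof.
move=> KA pA fp; have := ext_near fp.
have : \forall p' \near p, d_infty p' A <= scale n.
  apply/near_heisP; exists (scale n / 4) => [|p' h].
    by rewrite divr_gt0 ?scale_gt0.
  by apply: le_trans (d_triangle p _ _) _; lra.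
apply: filterS2 => p' p'A ->; have [e1 e2] := stage_avg KA p'A.
have e3 : stage n.+2 p' = (1 - avg (scale n.+1) (net n.+1) (fun=> 1) p') * stage n.+1 p'
  + avg (scale n.+1) (net n.+1) u p' by [].
by rewrite e3 e1 /fluct !avgB e2; ring.
Qed.

(** The averages see only net points within [(4 + 1) * scale n] of [A], where [u] differs from [u A]
    by at most [W]. Differentiating at the finer scale costs [8 / scale n], whence the constants
    [9 = 1 + 8]. *)
Lemma fluct_bounds : exists2 c : R, 0 <= c & forall n p A (W : R), 0 <= W ->
  d_infty p A <= scale n ->
  (forall q, K q -> d_infty q A <= 5 * scale n -> `|u q - u A| <= W) ->
  `|fluct n A p| <= c * W /\
  forall v, dirset v -> `|Dfluct n A v p| <= c * W / scale n.
Proof.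
have [c c0 hc] := @avg_bounds R.
exists (9 * c ^+ 2 + 9 * c) => [|n p A W W0 pA hW].
  by rewrite addr_ge0 ?mulr_ge0 ?sqr_ge0.
have sn := scale_gt0 n; have sn1 := scale_gt0 n.+1; have sS := scaleS n.
have [un Kn spn _] := hnet n; have [un1 Kn1 spn1 _] := hnet n.+1.
have close q : d_infty p q <= 4 * scale n -> d_infty q A <= 5 * scale n.
  by move=> pq; apply: le_trans (d_triangle p _ _) _; rewrite dC; lra.
have wn : {in net n, forall q, d_infty p q <= 4 * scale n -> `|u q - u A| <= W}.
  by move=> q /Kn Kq /close; exact: hW.
have wn1 : {in net n.+1, forall q, d_infty p q <= 4 * scale n.+1 -> `|u q - u A| <= W}.
  by move=> q /Kn1 Kq h; apply: hW => //; apply: close; lra.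
have [a1 b1] := hc _ _ p _ W sn un spn W0 wn.
have [a2 b2] := hc _ _ p _ W sn1 un1 spn1 W0 wn1.
have [a3 b3] := hc _ _ p (fun=> 1) 1 sn1 un1 spn1 ler01
  ltac:(by move=> ? ? ?; rewrite normr1).
have chi : `|1 - avg (scale n.+1) (net n.+1) (fun=> 1) p| <= 1 + c.
  by apply: le_trans (ler_normB _ _) _; rewrite normr1; lra.
have cW : 0 <= c * W by rewrite mulr_ge0.
have ccW : 0 <= c * (c * W) by rewrite mulr_ge0.
split=> [|v vd].
  apply: le_trans (ler_normD _ _) _; rewrite normrM.
  have := ler_pM (normr_ge0 _) (normr_ge0 _) chi a1; lra.
apply: le_trans (ler_normD _ _) _; apply: le_trans (lerD (ler_normD _ _) (lexx _)) _.
rewrite (normrM (1 - _)) (normrM (avg _ _ _ _)) normrN.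
have := ler_pM (normr_ge0 _) (normr_ge0 _) chi (b1 v vd).
have := ler_pM (normr_ge0 _) (normr_ge0 _) a1 (b3 v vd).
have := b2 v vd.
have -> : c * W / scale n.+1 = 8 * (c * W / scale n).
  by rewrite sS; field; rewrite gt_eqF.
have -> : c * W * (c * 1 / scale n.+1) = 8 * (c * (c * W / scale n)).
  by rewrite sS; field; rewrite gt_eqF.
have -> : (9 * c ^+ 2 + 9 * c) * W / scale n =
  9 * (c * (c * W / scale n)) + 9 * (c * W / scale n) by ring.
rewrite mulrDl mul1r => h1 h2 h3.
lra.
Qed.

(** Take the least [m] with [far 6 m p] and put [n = m - 2]. Minimality yields [A0] in [K] within
    [6 * scale n.+1 = 3 / 4 * scale n] of [p], so [ext_fluct] applies at [A0], while [far 6 m p]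
    bounds [scale n] by a multiple of the distance to [K]. At this scale [u] oscillates by
    [O(e' * scale n)], which makes the gradient [O(e')]. *)
Lemma ext_estimate (e : R) : 0 < e -> exists2 d : R, 0 < d &
  forall p A, ~ K p -> K A -> d_infty p A <= d ->
    `|ext p - u A| <= e * d_infty p A /\
    forall v a, dirset v -> hder ext v p a -> `|a| <= e.
Proof.
move=> e0; have [c c0 hc] := fluct_bounds.
(* The 9 comes from [d_infty A0 A <= 9 * d_infty p A]; 55 is [5 * 11], from the oscillation
   [5 * (e' * scale n)] and [scale n <= 11 * d_infty p A]. *)
pose e' := e / (9 + 55 * c).
have k0 : 0 < 9 + 55 * c by rewrite ltr_wpDr ?mulr_ge0.
have e'0 : 0 < e' by rewrite divr_gt0.
have eE : e = 9 * e' + 55 * (c * e').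
  by rewrite -[LHS](divfK (lt0r_neq0 k0)) -/e'; ring.
have ce' : 0 <= c * e' by rewrite mulr_ge0 ?(ltW e'0).
have [r r0 hr] := hu e'0.
(* The bound [r / 60] keeps [5 * scale n] and [9 * d_infty p A] below [r]; [scale 1] forces [m] to
   be at least two. *)
exists (Num.min (r / 60) (scale 1)).
  by rewrite lt_min divr_gt0// scale_gt0.
move=> p A Kp KA; rewrite le_min => /andP[dr d1].
have ex6 : exists n, `[< far 6 n p >].
  by have [n hn] := notin_far (ltr0n R 6) Kp; exists n; apply/asboolP.
case: (ex_minnP ex6) => m /asboolP fm minm.
have dm := fm _ KA.
have m2 : (2 <= m)%N.
  rewrite leqNgt; apply/negP; rewrite ltnS => /scale_le h.
  by have := scale_gt0 1; lra.
case: m m2 fm minm dm => [//|[//|n]] _ fn minn dn.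
have [A0 KA0 pA0] : exists2 A0, K A0 & d_infty p A0 < 6 * scale n.+1.
  apply: contrapT => h; suff /asboolP/minn : far 6 n.+1 p by rewrite ltnn.
  by move=> B KB; rewrite leNgt; apply/negP => h'; apply: h; exists B.
have sn := scale_gt0 n; have sS := scaleS n; have sS1 := scaleS n.+1.
have pA0' : d_infty p A0 <= 3 / 4 * scale n by lra.
have f5 : far 5 n.+2 p.
  by move=> B /fn; apply: le_trans; have := scale_gt0 n.+2; lra.
have W0 : 0 <= 5 * (e' * scale n).
  exact: mulr_ge0 (ler0n _ 5) (mulr_ge0 (ltW e'0) (ltW sn)).
have osc q : K q -> d_infty q A0 <= 5 * scale n -> `|u q - u A0| <= 5 * (e' * scale n).
  move=> Kq qA0; apply: le_trans (hr _ _ Kq KA0 _) _; first by lra.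
  by have : e' * d_infty q A0 <= e' * (5 * scale n); [rewrite ler_pM2l|lra].
have [b1 b2] := hc n p A0 _ W0 ltac:(lra) osc.
have near_p := ext_fluct KA0 pA0' f5.
split=> [|v a vd ha].
  rewrite (nbhs_singleton near_p).
  have A0A : d_infty A0 A <= 9 * d_infty p A.
    by apply: le_trans (d_triangle p _ _) _; rewrite dC; lra.
  have h1 : `|u A0 - u A| <= e' * (9 * d_infty p A).
    apply: le_trans (hr _ _ KA0 KA _) _; first lra.
    by rewrite ler_pM2l.
  have h2 : c * e' * scale n <= c * e' * (11 * d_infty p A).
    by rewrite ler_wpM2l//; lra.
  rewrite addrAC; apply: le_trans (ler_normD _ _) _.
  rewrite [X in X * _]eE; lra.
have := hder_near vd near_p ha.
move=> /hder_unique h; have [_ hf] := hC1_fluct n A0.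
rewrite (h _ ((hf v vd).2 p)); apply: le_trans (b2 v vd) _.
have -> : c * (5 * (e' * scale n)) / scale n = 5 * (c * e') by field; rewrite gt_eqF.
by rewrite [leRHS]eE; lra.
Qed.

(** The pieces of [ext] have different derivative formulas, so the derivative is chosen;
    [hder_unique] fixes it wherever one exists. *)
Definition Dext v p : R := xget 0 [set a | hder ext v p a].

Lemma hder_Dext v p a : hder ext v p a -> Dext v p = a.
Proof.
move=> h; have h' : hder ext v p (Dext v p).
  exact: (@xgetPex _ 0 [set a | hder ext v p a] (ex_intro _ a h)).
exact: hder_unique h' h.
Qed.

Lemma ext_littleo (e : R) : 0 < e -> exists2 d : R, 0 < d &
  forall p A, K A -> d_infty p A <= d -> `|ext p - u A| <= e * d_infty p A.
Proof.
move=> e0; have [d d0 hd] := ext_estimate e0; have [r r0 hr] := hu e0.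
exists (Num.min d r) => [|p A KA]; first by rewrite lt_min d0.
rewrite le_min => /andP[pd pr]; have [Kp|Kp] := pselect (K p).
  by rewrite extK//; exact: hr.
by have [] := hd p A Kp KA pd.
Qed.

Lemma hder_extK v A : dirset v -> K A -> hder ext v A 0.
Proof.
move=> vd KA; apply: is_derive_littleo => e e0.
have e2 : 0 < e / 2 by rewrite divr_gt0.
have [d d0 hd] := ext_littleo e2; exists (d / 2) => [|t]; first by rewrite divr_gt0.
rewrite ler_pdivlMr// => td; have dl := d_hline A t vd.
rewrite add0r mul0r subr0 hline0 (extK KA).
apply: le_trans (hd _ _ KA _) _; first by lra.
have : e / 2 * d_infty (hline A v t) A <= e / 2 * (2 * `|t|) by rewrite ler_pM2l.
lra.
Qed.

(** Off [K] the extension is locally a stage. At points of [K] the derivative is 0, and its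
    continuity there is the gradient bound of [ext_estimate]. *)
Lemma ext_hC1 : hC1 ext Dext.
Proof.
have [D hD] := stage_hC1.
have off p : ~ K p -> exists n, \forall p' \near p,
    ext p' = stage n p' /\ forall v, dirset v -> hder ext v p' (D n v p').
  move=> /(notin_far (ltr0n R 6))[n f6]; exists n.
  apply/near_heisP; exists (scale n) => [|p' p'p]; first exact: scale_gt0.
  have f5 : far 5 n p'.
    have -> : 5 = 6 - 1 :> R by ring.
    by apply: far_near f6 _; rewrite mul1r.
  have near_p' := ext_near f5; split; first exact: nbhs_singleton near_p'.
  move=> v vd; apply: (hder_near vd (f := stage n)).
    by apply: filterS near_p' => q ->.
  by have [_ /(_ v vd)[_]] := hD n; apply.
split.
  move=> p; have [Kp|/off[n hn]] := pselect (K p).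
    apply/(cvg_heisP ext p) => e e0; have [d d0 hd] := ext_littleo ltr01.
    exists (Num.min d e) => [|B]; first by rewrite lt_min d0.
    rewrite le_min (extK Kp) => /andP[Bd Be]; have := hd _ _ Kp Bd; lra.
  have [cs _] := hD n; rewrite /continuous_at (nbhs_singleton hn).1.
  apply: cvg_trans (cs p); apply: near_eq_cvg.
  by apply: filterS hn => q [].
move=> v vd; split; last first.
  move=> p; have [Kp|/off[n hn]] := pselect (K p).
    by rewrite (hder_Dext (hder_extK vd Kp)); exact: hder_extK.
  have [_ h] := nbhs_singleton hn; have {}h := h v vd.
  by rewrite (hder_Dext h).
move=> p; have [Kp|/off[n hn]] := pselect (K p).
  apply/(cvg_heisP (Dext v) p) => e e0; have [d d0 hd] := ext_estimate e0.
  exists d => // B Bd; rewrite (hder_Dext (hder_extK vd Kp)) subr0.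
  have [KB|KB] := pselect (K B).
    by rewrite (hder_Dext (hder_extK vd KB)) normr0 ltW.
  have [_ h] := hd B p KB Kp Bd; apply: (h v _ vd).
  have [m hm] := off _ KB; have [_ h'] := nbhs_singleton hm.
  by rewrite (hder_Dext (h' v vd)); exact: h'.
have [_ /(_ v vd)[cD _]] := hD n.
have e1 : \forall p' \near p, D n v p' = Dext v p'.
  by apply: filterS hn => q [_ h]; rewrite (hder_Dext (h v vd)).
rewrite /continuous_at -(nbhs_singleton e1).
by apply: cvg_trans (cD p); apply: near_eq_cvg.
Qed.

End whitney.

Lemma whitney_extension (R : realType) (K : set (heis R)) (u : heis R -> R) :
  compact K ->
  (forall e : R, 0 < e -> exists2 r : R, 0 < r &
    forall A B, K A -> K B -> d_infty A B <= r -> `|u A - u B| <= e * d_infty A B) ->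
  exists f Df, [/\ hC1 f Df, forall A, K A -> f A = u A &
    forall v A, dirset v -> K A -> Df v A = 0].
Proof.
move=> cK hu.
have [net hnet] := choice (fun n => spaced_net cK (scale_gt0 n)).
exists (ext K u net), (Dext K u net); split.
- exact: ext_hC1.
- by move=> A; exact: extK.
- by move=> v A vd KA; apply: hder_Dext; exact: hder_extK.
Qed.

(** * From distances to fibers to the Whitney condition *)

Lemma dist_fiber_ge (R : realType) (A B : heis R) (r : R) : 0 <= r ->
  `|B.1.1 - A.1.1| <= dist_to B (fiber A `&` heis_cball A r) /\
  `|B.1.2 - A.1.2| <= dist_to B (fiber A `&` heis_cball A r).
Proof.
(* The point [A] itself makes the set nonempty; the infimum of an empty set would be a default
   value. *)
move=> r0; have ne : [set d_infty B C | C in fiber A `&` heis_cball A r] !=set0.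
  by exists (d_infty B A), A => //; split => //; rewrite /heis_cball /= dxx.
split; apply: lb_le_inf ne _ => _ [C [CA _] <-].
  by rewrite -[A.1]CA /heis_proj -mulV_x; exact: rho_x.
by rewrite -[A.1]CA /heis_proj -mulV_y; exact: rho_y.
Qed.

Lemma whitney_condition (R : realType) (E U : set (heis R)) (eps : R -> R)
    (eps0 : eps r @[r --> 0^'+] --> (0 : R))
    (hE : forall A, (E `&` U) A -> forall r : R, 0 < r ->
      forall B, (E `&` heis_cball A r) B ->
        dist_to B (fiber A `&` heis_cball A r) <= eps r * r) (e : R) :
  0 < e -> exists2 d : R, 0 < d &
  forall A B, (E `&` U) A -> (E `&` U) B -> d_infty A B <= d ->
    `|A.1.1 - B.1.1| <= e * d_infty A B /\ `|A.1.2 - B.1.2| <= e * d_infty A B.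
Proof.
move=> e0; have /cvgrPdist_le/(_ e e0) := eps0.
move=> [d /= d0 hd]; exists (d / 2); first by rewrite divr_gt0.
move=> A B KA KB AB; set r := d_infty A B.
(* The hypothesis concerns positive radii only; at [r = 0] the horizontal coordinates coincide. *)
have [r0|r0] := ltP 0 r; last first.
  have re : r = 0 by apply/eqP; rewrite eq_le r0 d_ge0.
  have := rho_x (B^-1 * A)%g; have := rho_y (B^-1 * A)%g.
  by rewrite mulV_x mulV_y -/(d_infty A B) -/r re mulr0.
have er : eps r <= e.
  have : `|0 - eps r| <= e.
    apply: hd => //=; rewrite sub0r normrN gtr0_norm//.
    by apply: le_lt_trans AB _; rewrite gtr_pMr// invf_lt1// ltr1n.
  by rewrite sub0r normrN; apply: le_trans; exact: ler_norm.
have h : dist_to B (fiber A `&` heis_cball A r) <= e * r.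
  apply: le_trans (hE A KA r r0 B _) _; last by rewrite ler_pM2r.
  by split; [case: KB|rewrite /heis_cball /=].
have [hx hy] := dist_fiber_ge A B (ltW r0).
by rewrite [X in X <= _ /\ _]distrC [X in _ /\ X <= _]distrC; split; exact: le_trans h.
Qed.

Theorem proposition4p9 (R : realType) (E U : set (heis R)) (eps : R -> R)
    (cE : compact E) (cU : compact U)
    (eps0 : eps r @[r --> 0^'+] --> (0 : R))
    (hE : forall A, (E `&` U) A -> forall r : R, 0 < r ->
      forall B, (E `&` heis_cball A r) B ->
        dist_to B (fiber A `&` heis_cball A r) <= eps r * r) :
  exists F : heis R -> R * R,
    [/\ C1H F,
        forall A, (E `&` U) A -> F A = 0 &
        forall A, (E `&` U) A -> dh F A = id].
Proof.
have cK : compact (E `&` U) by apply: compact_closedI (compact_heis_closed cU).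
have hK := whitney_condition eps0 hE.
have [|f [Df [hf f0 Df0]]] := @whitney_extension R (E `&` U) (fun A => A.1.1) cK.
  move=> e /hK[d d0 hd]; exists d => // A B KA KB AB.
  by have [] := hd A B KA KB AB.
have [|g [Dg [hg g0 Dg0]]] := @whitney_extension R (E `&` U) (fun A => A.1.2) cK.
  move=> e /hK[d d0 hd]; exists d => // A B KA KB AB.
  by have [] := hd A B KA KB AB.
have hF := hC1D hC1_x (hC1M (hC1_cst (-1)) hf).
have hG := hC1D hC1_y (hC1M (hC1_cst (-1)) hg).
exists (fun A => (A.1.1 + -1 * f A, A.1.2 + -1 * g A)).
split; first exact: hC1_C1H hF hG.
  by move=> A KA /=; rewrite f0// g0// !mulN1r !subrr.
move=> A KA; apply/funext => -[x y].
(* The derivatives of [f] and [g] vanish at [A], so only those of the two coordinates remain. *)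
rewrite /dh (hC1_Dh _ hF hG) /hmap /= !Df0 ?Dg0//; try exact: dirset_X; try exact: dirset_Y.
by congr (_, _); ring.
Qed.
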